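(* Let $V:f=0$ be a reduced plane curve of degree $d$ in $\mathbb{P}^2$, where $f\in\mathbb{C}[x,y,z]$ is homogeneous of degree $d$, essentially involves the three variables, and has Waring rank $5$. Suppose that $f=\ell_1^d+\cdots+\ell_5^d$ is a Waring decomposition $(\mathcal{D})$ of $f$ such that the associated line arrangement $\mathcal{A}_{\mathcal{D}}:\ell_1\cdots\ell_5=0$ has only double points (there are $n_2=10$ of them). Then, up to a linear change of coordinates, $$f=x^d+y^d+z^d+(a_1x+b_1y+c_1z)^d+(a_2x+b_2y+c_2z)^d$$ with $(a_1,b_1,c_1,a_2,b_2,c_2)\in(\mathbb{C}^* )^6$ and $$a_1b_2-a_2b_1\neq 0,\qquad a_1c_2-a_2c_1\neq 0,\qquad b_1c_2-b_2c_1\neq 0.$$ Then, in these coordinates, the curve $V:f=0$ can have only singularities $p=(p_1:p_2:p_3)$ of type $A_m$ (for some $m\geq 1$ depending on $p$). Moreover, if $p_1p_2p_3=0$, then $p$ can be only an $A_1$-singularity.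
   Context: The Waring rank of a homogeneous polynomial $f$ of degree $d$ over $\mathbb{C}$ is the minimal $r$ such that $f=\ell_1^d+\cdots+\ell_r^d$ with linear forms $\ell_j$; such an expression with $r$ minimal is called a Waring decomposition. The form $f$ essentially involves the variables $x,y,z$ if it cannot be written, after a linear change of coordinates, as a polynomial in fewer than three variables; equivalently the $\ell_j$ span the space of all linear forms. For a line arrangement, a double point is a point lying on exactly two lines, and $n_2$ is the number of double points. A plane curve singularity is of type $A_m$ if it is analytically isomorphic to $v^2+w^{m+1}=0$ at the origin of $\mathbb{C}^2$. *)

(* Defs.v *)
From HB Require Import structures.
From mathcomp Require Import all_boot all_order all_algebra.
From mathcomp Require Import all_classical all_reals all_analysis.
From mathcomp Require Export complex.
(* The notations of mpoly.v clash with those of mathcomp-analysis. *)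
From mathcomp Require Export -(notations) mpoly.

Set Implicit Arguments.
Unset Strict Implicit.
Unset Printing Implicit Defensive.

Import Order.TTheory GRing.Theory Num.Theory.
Import numFieldNormedType.Exports.

Local Open Scope classical_set_scope.
Local Open Scope ring_scope.

(* Ternary forms are [mpoly 3 K] and points of the projective plane are given
   by nonzero vectors of homogeneous coordinates in ['rV[K]_3].  The definitions
   are generic in a numFieldType [K], whose topology is the one of its norm; in
   the theorem [K] is the field [R[i]] of complex numbers. *)

Definition var (K : numFieldType) (i : 'I_3) : mpoly 3 K := mpolyX K (mnm1 i).

Definition lform (K : numFieldType) (a b c : K) : mpoly 3 K :=
  a *: var K 0 + b *: var K 1 + c *: var K 2.

Definition ev (K : numFieldType) (f : mpoly 3 K) (p : 'rV[K]_3) : K :=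
  meval (p 0) f.

(* The form f (M x), where x is the column vector of the variables. *)
Definition lin_subst (K : numFieldType) (M : 'M[K]_3) (f : mpoly 3 K) :
  mpoly 3 K :=
  comp_mpoly [tuple \sum_(j < 3) M i j *: var K j | i < 3] f.

Definition reduced (K : numFieldType) (f : mpoly 3 K) : Prop :=
  forall g h : mpoly 3 K, f = g ^+ 2 * h -> g \is a GRing.unit.

Definition essentially_ternary (K : numFieldType) (f : mpoly 3 K) : Prop :=
  forall M : 'M[K]_3, M \in unitmx ->
  ~ exists g : mpoly 2 K, lin_subst M f = mwiden g.

Definition power_sum (K : numFieldType) (d : nat) (f : mpoly 3 K) (r : nat)
    (l : 'I_r -> mpoly 3 K) : Prop :=
  (forall j, l j \is ishomog1 1 mdeg) /\ f = \sum_(j < r) l j ^+ d.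

Definition waring_rank (K : numFieldType) (d : nat) (f : mpoly 3 K) (r : nat) :
  Prop :=
  (exists l : 'I_r -> mpoly 3 K, power_sum d f l) /\
  (forall s (l : 'I_s -> mpoly 3 K), power_sum d f l -> (r <= s)%N).

Definition waring_decomposition (K : numFieldType) (d : nat) (f : mpoly 3 K)
    (r : nat) (l : 'I_r -> mpoly 3 K) : Prop :=
  waring_rank d f r /\ power_sum d f l.

Definition nb_lines_through (K : numFieldType) (r : nat)
    (l : 'I_r -> mpoly 3 K) (p : 'rV[K]_3) : nat :=
  #|[pred j | ev (l j) p == 0]|.

Definition only_double_points (K : numFieldType) (r : nat)
    (l : 'I_r -> mpoly 3 K) : Prop :=
  forall p : 'rV[K]_3, p != 0 ->
  (2 <= nb_lines_through l p)%N -> nb_lines_through l p = 2.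

(* A subset of the projective plane, seen as the set of the lines of K^3. *)
Definition double_points (K : numFieldType) (r : nat)
    (l : 'I_r -> mpoly 3 K) : set {vspace 'rV[K]_3} :=
  [set <[p]>%VS | p in [set p | p != 0 /\ nb_lines_through l p = 2]].

Definition five_powers_form (K : numFieldType) (d : nat)
    (a1 b1 c1 a2 b2 c2 : K) : mpoly 3 K :=
  var K 0 ^+ d + var K 1 ^+ d + var K 2 ^+ d
  + lform a1 b1 c1 ^+ d + lform a2 b2 c2 ^+ d.

Definition general_coefficients (K : numFieldType)
    (a1 b1 c1 a2 b2 c2 : K) : Prop :=
  [&& a1 != 0, b1 != 0, c1 != 0, a2 != 0, b2 != 0 & c2 != 0] /\
  [/\ a1 * b2 - a2 * b1 != 0, a1 * c2 - a2 * c1 != 0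
    & b1 * c2 - b2 * c1 != 0].

Definition singular_point (K : numFieldType) (f : mpoly 3 K) (p : 'rV[K]_3) :
  Prop :=
  [/\ p != 0, ev f p = 0 & forall i : 'I_3, ev (mderiv i f) p = 0].

(* Fréchet differentiability over K = R[i] on a neighbourhood of x. *)
Definition holomorphic_at (K : numFieldType) (V W : normedModType K)
    (h : V -> W) (x : V) : Prop :=
  \forall y \near x, differentiable h y.

(* The germs at p and q of the analytic curves F = 0 and G = 0, with the
   structure sheaves defined by these equations, are isomorphic: a germ of
   biholomorphism phi pulls F back to G, up to an invertible factor. *)
Definition analytically_isomorphic (K : numFieldType)
    (F : 'rV[K]_2 -> K) (p : 'rV[K]_2) (G : 'rV[K]_2 -> K) (q : 'rV[K]_2) :
  Prop :=
  exists (phi psi : 'rV[K]_2 -> 'rV[K]_2) (u : 'rV[K]_2 -> K),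
    [/\ phi q = p, holomorphic_at phi q, holomorphic_at psi p,
        \forall z \near q, psi (phi z) = z
      & \forall z \near p, phi (psi z) = z] /\
    [/\ holomorphic_at u q, u q != 0
      & \forall z \near q, F (phi z) = u z * G z].

(* The standard affine chart where the i-th homogeneous coordinate is 1, and its
   inverse on the points with nonzero i-th homogeneous coordinate. *)
Definition chart (K : numFieldType) (i : 'I_3) (q : 'rV[K]_2) : 'rV[K]_3 :=
  \row_k (if unlift i k is Some j then q 0 j else 1).

Definition chart_coord (K : numFieldType) (i : 'I_3) (p : 'rV[K]_3) :
  'rV[K]_2 :=
  \row_j (p 0 (lift i j) / p 0 i).

Definition type_A (K : numFieldType) (m : nat) (f : mpoly 3 K)
    (p : 'rV[K]_3) : Prop :=
  exists2 i : 'I_3, p 0 i != 0 &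
  analytically_isomorphic (fun q => ev f (chart i q)) (chart_coord i p)
    (fun z => z 0 0 ^+ 2 + z 0 1 ^+ m.+1) 0.

(* Main.v *)
Require Import Defs.
From HB Require Import structures.
From mathcomp Require Import all_boot all_order all_algebra.
From mathcomp Require Import all_classical all_reals all_analysis.
From mathcomp Require Import perm ring.

(** Why the theorem holds. Write f = l_1^d + ... + l_5^d. That the lines have only
    double points means that no three of the forms l_j vanish at a common point of
    the plane. Hence two points killed by the same two forms are proportional and
    the double points correspond to the ten pairs of forms; and taking three of the
    forms as coordinates puts f in the normal form, the conditions on the
    coefficients of the other two forms saying again that no three of the five
    lines meet.

    Degrees at most two are degenerate. A sum of 0-th powers is constant and a
    linear form has Waring rank at most 1. In degree 2 there is no singular point: a
    quadratic form that is singular at p does not change along the direction p, so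
    in coordinates where p is a coordinate point it does not depend on the
    corresponding variable ([quadric_nonsingular]).

    Let d >= 3 and let p be a singular point of the sum of five powers. The Hessian
    form at p is the sum of the l_j(p)^(d-2) l_j^2. If it were zero, its
    off-diagonal coefficients would force the last two forms to vanish at p, and
    then p = 0. So the affine equation F(s, t) of the curve at p can be arranged to
    satisfy F_ss <> 0. If moreover p lies on a coordinate line, a direct computation
    shows that the Hessian of F is nondegenerate ([curve_det]).

    The splitting lemma ([splitting]) is proved with polynomials only. By Hensel
    lifting there is a polynomial T with F_s(T(t), t) = O(t^n), and
      F(T + s, t) = F(T, t) + F_s(T, t) s + h s^2.
    If F(T, t) has order N < n in t, the middle term is absorbed by the first one
    and F = t^N C + s^2 h with polynomials C and h that are nonzero at the origin.
    Then (s, t) |-> (s sqrt(h / C), t) is biholomorphic and F / C becomes s^2 + t^N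
    ([normal_form_iso]). Its inverse and the square root are roots of polynomials
    whose coefficients depend holomorphically on a parameter, which makes the
    following form of the implicit function theorem sufficient
    ([implicit_root]): the existence of a root close to a given simple root comes
    from the algebraic closedness of the field and a bound on the logarithmic
    derivative; uniqueness and differentiability come from the divided difference.

    It remains to bound the order N. If F(T, t) had high order too, all partial
    derivatives of f would vanish to high order along a curve with coordinates
    (x(t), y(t), 1). The relations x^e + a1 u^e + a2 v^e = 0 and
    1 + c1 u^e + c2 v^e = 0 with e = d - 1, together with the linear relation
    between x, u and v, give by differentiation and elimination a nonzero polynomial
    M with x' M(x) = 0 to high order. Splitting M into linear factors shows that x,
    and then u and y, have derivative zero at t = 0, which is impossible on a curve
    with a nonzero tangent vector ([no_flat_curve]). When the Hessian is
    nondegenerate, order 2 of the derivatives is already impossible, so N = 2 and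
    the singularity is of type A_1. *)

Set Implicit Arguments.
Unset Strict Implicit.
Unset Printing Implicit Defensive.
Import Order.TTheory GRing.Theory Num.Theory.
Import numFieldNormedType.Exports.
Local Open Scope classical_set_scope.
Local Open Scope ring_scope.

(** * Differentiability *)

Section Differentiability.
Context {K : numFieldType} {V W : normedModType K}.

(** Estimates with explicit epsilons can be transported along [near_eq_differentiable]
    and multiplied in [differentiable_mul0], which the little-o form does not
    allow directly. *)
Lemma differentiable_epsP (f : V -> W) (x : V) :
  differentiable f x <->
  exists2 L : {linear V -> W}, continuous L &
    forall e : K, 0 < e -> \forall y \near x, `|f y - f x - L (y - x)| <= e * `|y - x|.
Proof.
split=> [df|[L Lc fL]].
  exists ('d f x); first exact: diff_continuous.
  move=> e e0; have /eqaddoP := diff_locally df.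
  move=> /(_ e e0).
  rewrite -[X in X -> _]/(\forall h \near (0 : V), _) (near_shift x 0) /=.
  move=> h; apply: filterS h => y.
  by rewrite /= !fctE /= sub0r subrK opprD addrA.
have e1 : f \o shift x = cst (f x) + L +o_ 0 id.
  apply/eqaddoP => e e0.
  change (\forall h \near (0 : V), `|(f \o shift x - (cst (f x) + L)) h| <= e * `|h|).
  rewrite (near_shift x 0) /=.
  apply: filterS (fL e e0) => y.
  by rewrite /= !fctE /= sub0r subrK opprD addrA.
by apply/diff_locallyP; rewrite (diff_unique Lc e1).
Qed.

Lemma near_eq_differentiable (f g : V -> W) (x : V) :
  (\forall y \near x, f y = g y) -> differentiable g x -> differentiable f x.
Proof.
move=> fg /differentiable_epsP [L Lc gL]; apply/differentiable_epsP; exists L => // e e0.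
have fx := nbhs_singleton fg.
near=> y.
rewrite (near fg y) // fx.
by near: y; exact: gL.
Unshelve. all: by end_near. Qed.

End Differentiability.

(** The difference between [h * k] and [h * k x] is [h * (k - k x)], which is
    o(y - x) because [h] is O(y - x) and [k] is continuous. The point is that [k]
    need not be differentiable: for an implicit function, [k] is the inverse of a
    divided difference that involves the function itself. *)
Lemma differentiable_mul0 (K : numFieldType) (V : normedModType K) (h k : V -> K) (x : V) :
  h x = 0 -> differentiable h x -> {for x, continuous k} ->
  differentiable (fun y => h y * k y) x.
Proof.
move=> h0 dh kc.
have [L0 L0c hL0] := (differentiable_epsP h x).1 dh.
apply/differentiable_epsP.
have := differentiable_epsP (fun y => h y * k x) x.
have dhk : differentiable (fun y => h y * k x) x.
  by apply: differentiableM => //; exact: differentiable_cst.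
move=> /iffLR /(_ dhk) [L Lc hL]; exists L => // e e0.
have [M M0 LM] := linear_lipschitz L0c.
have hbd : \forall y \near x, `|h y| <= (1 + M) * `|y - x|.
  have := hL0 1 ltr01; apply: filterS => y.
  rewrite h0 subr0 mul1r => hy.
  rewrite -(subrK (L0 (y - x)) (h y)) (le_trans (ler_normD _ _)) //.
  by rewrite mulrDl mul1r lerD.
have M1 : 0 < 1 + M by rewrite addr_gt0.
have kbd : \forall y \near x, `|k x - k y| < e / 2 / (1 + M).
  have e2 : 0 < e / 2 / (1 + M) by rewrite !divr_gt0.
  by move/cvgr_dist_lt : kc => /(_ _ e2).
near=> y.
have h1 : `|h y * k x - h x * k x - L (y - x)| <= e / 2 * `|y - x|.
  by near: y; apply: hL; rewrite divr_gt0.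
rewrite [leRHS](_ : _ = e / 2 * `|y - x| + e / 2 / (1 + M) * ((1 + M) * `|y - x|)); last first.
  by rewrite mulrA divfK ?gt_eqF // -mulrDl -splitr.
rewrite (_ : h y * k y - _ - _ = (h y * k x - h x * k x - L (y - x)) - (k x - k y) * h y); last first.
  by rewrite h0; ring.
rewrite (le_trans (ler_normB _ _)) // lerD // normrM ler_pM //.
  by apply: ltW; near: y.
by near: y.
Unshelve. all: by end_near. Qed.

(** * Roots of polynomials depending on a parameter *)

(** The logarithmic derivative p'/p at [a] is the sum of the 1 / (a - r). *)
Lemma deriv_bound_of_far_roots (K : numFieldType) (rs : seq K) (a e : K) : 0 <= e ->
  {in rs, forall r, e <= `|a - r|} ->
  let p := \prod_(r <- rs) ('X - r%:P) in
  e * `|p^`().[a]| <= (size rs)%:R * `|p.[a]|.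
Proof.
move=> e0; elim: rs => [|r rs IH] far /=.
  by rewrite big_nil derivC horner0 normr0 mulr0 mul0r.
have {}IH := IH (fun s sin => far s (@mem_behead _ (r :: rs) s sin)).
have er : e <= `|a - r| by apply: far; rewrite mem_head.
rewrite big_cons derivM derivXsubC mul1r hornerD !hornerM hornerXsubC.
rewrite (le_trans (ler_wpM2l e0 (ler_normD _ _))) // mulrDr !normrM.
rewrite -natr1 mulrDl mul1r addrC lerD //.
  by rewrite mulrCA [leRHS]mulrCA ler_wpM2l.
by rewrite ler_wpM2r.
Qed.

(** Algebraic closedness replaces the contraction principle: if all roots were at
    distance at least [e], the logarithmic derivative at [a] would be too small. *)
Lemma root_near (K : numClosedFieldType) (p : {poly K}) (a e : K) : 0 < e ->
  (size p)%:R * `|p.[a]| < e * `|p^`().[a]| ->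
  exists2 w, root p w & `|w - a| < e.
Proof.
move=> e0 pa; have p0 : p != 0.
  by apply: contraTneq pa => ->; rewrite derivC !horner0 !normr0 !mulr0 ltxx.
have [rs def_p] := closed_field_poly_normal p.
have [/hasP[w wrs wa]|far] := boolP (has (fun w => `|w - a| < e) rs).
  exists w => //; rewrite def_p rootZ ?lead_coef_eq0 // root_prod_XsubC //.
have := @deriv_bound_of_far_roots K rs a e (ltW e0).
have h : {in rs, forall r, e <= `|a - r|}.
  move=> r rrs; rewrite real_leNgt ?(gtr0_real e0) ?normr_real // distrC.
  by apply: contra far => ?; apply/hasP; exists r.
move=> /(_ h) /=; set q := \prod_(r <- rs) _.
have def_pq : p = lead_coef p *: q by [].
have sz : size p = (size rs).+1.
  by rewrite def_pq size_scale ?lead_coef_eq0 // size_prod_XsubC.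
move=> hq; suff : e * `|p^`().[a]| <= (size p)%:R * `|p.[a]|.
  by move=> /(lt_le_trans pa); rewrite ltxx.
rewrite def_pq derivZ !hornerZ !normrM mulrCA [leRHS]mulrCA -def_pq ler_wpM2l //.
by rewrite (le_trans hq) // ler_wpM2r // sz ler_nat.
Qed.

(** The number of terms is a parameter and not [size p], so that the formula stays
    the same when the polynomial varies. *)
Definition divdiff (R : comNzRingType) (D : nat) (p : {poly R}) (a b : R) : R :=
  \sum_(k < D) p`_k * \sum_(i < k) a ^+ (k.-1 - i) * b ^+ i.

Lemma divdiffP (R : comNzRingType) D (p : {poly R}) (a b : R) : (size p <= D)%N ->
  p.[a] - p.[b] = (a - b) * divdiff D p a b.
Proof.
move=> pD; rewrite !(horner_coef_wide _ pD) -sumrB mulr_sumr; apply: eq_bigr => k _.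
by rewrite -mulrBr subrXX mulrCA.
Qed.

Lemma divdiff_diag (R : comNzRingType) D (p : {poly R}) (a : R) : (size p <= D)%N ->
  divdiff D p a a = p^`().[a].
Proof.
move=> pD; have -> : p = \sum_(k < D) p`_k *: 'X^k.
  apply/polyP => i; rewrite -poly_def coef_poly; case: ltnP => // Di.
  by rewrite nth_default // (leq_trans pD).
rewrite linear_sum horner_sum /=; apply: eq_bigr => k _.
rewrite derivZ derivXn hornerZ hornerMn hornerXn.
rewrite -poly_def coef_poly ltn_ord; congr (_ * _).
rewrite (eq_bigr (fun=> a ^+ k.-1)) ?sumr_const ?card_ord // => i _.
by rewrite -exprD subnK // -ltnS (leq_trans (ltn_ord i)) // leqSpred.
Qed.

Section PolynomialLimits.
Context {K : numFieldType} {T : Type} {F : set_system T} {FF : Filter F}.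

Lemma cvg_exprn (f : T -> K) (a : K) n :
  f x @[x --> F] --> a -> f x ^+ n @[x --> F] --> a ^+ n.
Proof.
move=> fa; elim: n => [|n IH].
  rewrite expr0; under eq_fun do rewrite expr0; exact: cvg_cst.
by rewrite exprS; under eq_fun do rewrite exprS; exact: cvgM.
Qed.

Lemma cvg_divdiff D (P : T -> {poly K}) (p : {poly K}) (f g : T -> K) (a b : K) :
  (forall k, (P x)`_k @[x --> F] --> p`_k) ->
  f x @[x --> F] --> a -> g x @[x --> F] --> b ->
  divdiff D (P x) (f x) (g x) @[x --> F] --> divdiff D p a b.
Proof.
move=> Pp fa gb.
apply: (cvg_big (@add_continuous K)) => k _.
apply: cvgM => //; apply: (cvg_big (@add_continuous K)) => i _.
by apply: cvgM; exact: cvg_exprn.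
Qed.

Lemma cvg_horner D (P : T -> {poly K}) (p : {poly K}) (f : T -> K) (a : K) :
  (forall x, size (P x) <= D)%N -> (size p <= D)%N ->
  (forall k, (P x)`_k @[x --> F] --> p`_k) ->
  f x @[x --> F] --> a -> (P x).[f x] @[x --> F] --> p.[a].
Proof.
move=> PD pD Pp fa.
rewrite (horner_coef_wide _ pD); under eq_fun do rewrite (horner_coef_wide _ (PD _)).
apply: (cvg_big (@add_continuous K)) => k _.
by apply: cvgM => //; exact: cvg_exprn.
Qed.

End PolynomialLimits.

Section ImplicitRoot.
Context {K : numClosedFieldType} {V : normedModType K}.
Variables (D : nat) (Phi : V -> {poly K}).
Hypothesis sizePhi : forall z, (size (Phi z) <= D)%N.
Hypothesis diffPhi : forall k z, differentiable (fun z => (Phi z)`_k) z.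

Let cvgPhi k z : (Phi y)`_k @[y --> z] --> (Phi z)`_k.
Proof. exact: differentiable_continuous (diffPhi k z). Qed.

Lemma differentiable_Phi (w : K) z : differentiable (fun y => (Phi y).[w]) z.
Proof.
under eq_fun do rewrite (horner_coef_wide _ (sizePhi _)).
have := @differentiable_sum K V K D (fun k y => (Phi y)`_k * w ^+ k) z.
rewrite fct_sumE; apply => k.
by apply: differentiableM; [exact: diffPhi|exact: differentiable_cst].
Qed.

Lemma root_near_root (z : V) (a e : K) : 0 < e -> root (Phi z) a ->
  (Phi z)^`().[a] != 0 ->
  \forall y \near z, exists2 w, root (Phi y) w & `|w - a| < e.
Proof.
move=> e0 /eqP ra da; have eR := gtr0_real e0.
have h1 : (e * `|divdiff D (Phi y) a a| - D%:R * `|(Phi y).[a]|) @[y --> z] -->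
    e * `|divdiff D (Phi z) a a| - D%:R * `|(Phi z).[a]|.
  apply: cvgB; apply: cvgM; try exact: cvg_cst; apply: cvg_norm.
    by apply: cvg_divdiff; [move=> k; exact: cvgPhi|exact: cvg_cst|exact: cvg_cst].
  by apply: (@cvg_horner _ _ _ _ D); 
    [exact: sizePhi|exact: sizePhi|move=> k; exact: cvgPhi|exact: cvg_cst].
have pos : 0 < e * `|divdiff D (Phi z) a a| - D%:R * `|(Phi z).[a]|.
  by rewrite ra normr0 mulr0 subr0 mulr_gt0 // divdiff_diag // normr_gt0.
move/cvgr_dist_lt : h1 => /(_ _ pos); apply: filterS => y hy.
apply: root_near e0 _.
have /(le_lt_trans) : D%:R * `|(Phi y).[a]| < e * `|(Phi y)^`().[a]|; last first.
  by apply; rewrite ler_wpM2r // ler_nat.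
rewrite -(divdiff_diag _ (sizePhi y)) -subr_gt0.
move: hy; rewrite distrC real_ltr_distl ?subrr; first by case/andP.
by rewrite !rpredB // rpredM // ?normr_real ?realn.
Qed.

(** Implicit function theorem for a simple root of a polynomial of bounded size
    whose coefficients depend differentiably on [z]. A root close to [w0] exists by
    [root_near_root]. It is unique because the divided difference at two roots w and
    w' is zero unless w = w', whereas near [w0] it is close to the derivative at
    [w0]. The same identity gives
    om z - om z1 = - Phi_z(om z1) / divdiff (om z) (om z1),
    a differentiable function that vanishes at [z1] times a continuous one. *)
Lemma implicit_root (z0 : V) (w0 : K) :
  root (Phi z0) w0 -> (Phi z0)^`().[w0] != 0 ->
  exists om : V -> K,
    [/\ om z0 = w0, \forall z \near z0, differentiable om z,
        \forall z \near z0, root (Phi z) (om z)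
      & exists2 e : K, 0 < e &
        \forall z \near z0, forall w, `|w - w0| < e -> root (Phi z) w -> w = om z].
Proof.
move=> rw0 dw0.
pose dd (x : K * K * V) := divdiff D (Phi x.2) x.1.1 x.1.2.
have c1 : continuous (fun x : (K * K) * V => x.1.1).
  by move=> x; apply: (@continuous_comp _ _ _ fst fst); exact: cvg_fst.
have c2 : continuous (fun x : (K * K) * V => x.1.2).
  by move=> x; apply: (@continuous_comp _ _ _ fst snd); [exact: cvg_fst|exact: cvg_snd].
have ddc : continuous dd.
  move=> x; apply: cvg_divdiff; [move=> k|exact: c1|exact: c2].
  apply: (@continuous_comp _ _ _ snd (fun z => (Phi z)`_k)); [exact: cvg_snd|exact: cvgPhi].
have : \forall x \near ((w0, w0), z0), dd x != 0.
  have dd0 : dd ((w0, w0), z0) != 0 by rewrite /dd /= divdiff_diag.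
  exact: cvgr_neq0 (ddc _) dd0.
move=> /nbhs_ballP [r /= r0 ddN0].
(* Within distance r of the base point, the divided difference does not vanish. *)
have dr w w' z : `|w - w0| < r -> `|w' - w0| < r -> ball z0 r z -> dd ((w, w'), z) != 0.
  by move=> ww w'w zz; apply: ddN0; split=> //; split=> /=; rewrite -ball_normE /= distrC.
have uniq w w' z : `|w - w0| < r -> `|w' - w0| < r -> ball z0 r z ->
    root (Phi z) w -> root (Phi z) w' -> w = w'.
  move=> ww w'w zz /eqP rw /eqP rw'; apply/eqP; rewrite -subr_eq0.
  have := divdiffP w w' (sizePhi z); rewrite rw rw' subrr => /esym/eqP.
  by rewrite mulf_eq0 => /orP[//|]; have := dr _ _ _ ww w'w zz; rewrite /dd /= => /negbTE ->.
pose om z := xget w0 [set w | root (Phi z) w /\ `|w - w0| < r].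
pose N z := ball z0 r z /\ exists2 w, root (Phi z) w & `|w - w0| < r.
have Nnear : \forall z \near z0, N z.
  near=> z; split; first by near: z; exact: nbhsx_ballx.
  by near: z; exact: root_near_root.
have omP z : N z -> root (Phi z) (om z) /\ `|om z - w0| < r.
  by move=> [_ [w rw ww]]; apply: (@xgetPex _ w0 [set w | root (Phi z) w /\ `|w - w0| < r]); exists w.
have omU z w : N z -> `|w - w0| < r -> root (Phi z) w -> w = om z.
  by move=> Nz ww rw; have [? ?] := omP _ Nz; apply: (uniq _ _ z) => //; exact: Nz.1.
exists om; split.
- by rewrite -(omU z0 w0) ?subrr ?normr0 //; exact: nbhs_singleton Nnear.
- move/nbhs_interior : Nnear; apply: filterS => z1 N1.
  have Nz1 := nbhs_singleton N1; have [r1 w1r] := omP _ Nz1.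
  have omc : om y @[y --> z1] --> om z1.
    move=> A A1; have : nbhs (om z1) (A `&` ball w0 r).
      apply: filterI => //; apply: open_nbhs_nbhs; split; first exact: ball_open.
      by rewrite -ball_normE /= distrC.
    move=> /nbhs_ballP[e /= e0 eA].
    have := root_near_root e0 r1.
    rewrite -(divdiff_diag _ (sizePhi _)) => /(_ (dr _ _ _ w1r w1r Nz1.1)) ex.
    change (\forall y \near z1, A (om y)).
    near=> y; have Ny : N y by near: y.
    have [w rw we] : exists2 w, root (Phi y) w & `|w - om z1| < e by near: y.
    have [Aw wr] : (A `&` ball w0 r) w by apply: eA; rewrite -ball_normE /= distrC.
    rewrite /= -(omU y w) //.
    by move: wr; rewrite -ball_normE /= distrC.
  apply: (@near_eq_differentiable _ _ _ _
      (fun y => om z1 + - (Phi y).[om z1] * (dd ((om y, om z1), y))^-1)).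
    near=> y; have Ny : N y by near: y.
    have [ry yr] := omP _ Ny; have d0 := dr _ _ _ yr w1r Ny.1.
    have := divdiffP (om y) (om z1) (sizePhi y); rewrite (eqP ry) sub0r => ->.
    by rewrite mulfK // addrC subrK.
  apply: differentiableD; first exact: differentiable_cst.
  apply: differentiable_mul0.
  - by rewrite (eqP r1) oppr0.
  - by apply: differentiableN; exact: differentiable_Phi.
  - apply: cvgV; first exact: dr Nz1.1.
    apply: cvg_divdiff => //; [by move=> k; exact: cvgPhi|exact: cvg_cst].
- by apply: filterS Nnear => z /omP[].
- by exists r => //; apply: filterS Nnear => z Nz w; exact: omU.
Unshelve. all: by end_near. Qed.
End ImplicitRoot.

(** * Germs of the form s^2 h + t^N C *)

Section Dilation.
Context {K : numFieldType}.

Lemma differentiable_expr (V : normedModType K) (f : V -> K) n z :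
  differentiable f z -> differentiable (fun y => f y ^+ n) z.
Proof.
move=> df; elim: n => [|n IH]; first exact: differentiable_cst.
by under eq_fun do rewrite exprS; exact: differentiableM.
Qed.

Lemma differentiable_horner (V : normedModType K) (p : {poly K}) (f : V -> K) z :
  differentiable f z -> differentiable (fun y => p.[f y]) z.
Proof.
move=> df; under eq_fun do rewrite horner_coef.
have := @differentiable_sum K V K (size p) (fun k y => p`_k * f y ^+ k) z.
rewrite fct_sumE; apply => k.
by apply: differentiableM; [exact: differentiable_cst|exact: differentiable_expr].
Qed.

Lemma differentiable_horner2 (V : normedModType K) (p : {poly {poly K}}) (f g : V -> K) z :
  differentiable f z -> differentiable g z ->
  differentiable (fun y => p.[(f y)%:P].[g y]) z.
Proof.
move=> df dg; under eq_fun do rewrite (horner_coef p) horner_sum.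
have := @differentiable_sum K V K (size p) (fun k y => (p`_k * (f y)%:P ^+ k).[g y]) z.
rewrite fct_sumE; apply => k.
under eq_fun do rewrite hornerM horner_exp hornerC.
by apply: differentiableM; [exact: differentiable_horner|exact: differentiable_expr].
Qed.

(** The polynomial p(v w, t) in the variable w, given by its coefficients, which are
    visibly differentiable functions of [v] and [t]. *)
Definition dilate (p : {poly {poly K}}) (v t : K) : {poly K} :=
  \poly_(i < size p) (v ^+ i * (p`_i).[t]).

Lemma horner_dilate p v t w : (dilate p v t).[w] = p.[(v * w)%:P].[t].
Proof.
rewrite horner_poly (horner_coef p) horner_sum; apply: eq_bigr => i _.
by rewrite hornerM horner_exp hornerC exprMn mulrAC mulrC mulrA.
Qed.

Lemma differentiable_coef_dilate (V : normedModType K) (p : {poly {poly K}}) (f g : V -> K) z k :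
  differentiable f z -> differentiable g z ->
  differentiable (fun y => (dilate p (f y) (g y))`_k) z.
Proof.
move=> df dg; under eq_fun do rewrite coef_poly.
case: (k < size p)%N; last exact: differentiable_cst.
by apply: differentiableM; [exact: differentiable_expr|exact: differentiable_horner].
Qed.

Definition row2 (a b : K) : 'rV[K]_2 := \row_j (if j == 0 then a else b).

Lemma row2E0 a b : row2 a b 0 0 = a. Proof. by rewrite mxE. Qed.
Lemma row2E1 a b : row2 a b 0 1 = b. Proof. by rewrite mxE. Qed.

Lemma row2K (q : 'rV[K]_2) : row2 (q 0 0) (q 0 1) = q.
Proof.
by apply/rowP => -[[|[|//]] i]; rewrite mxE /=; congr (q _ _); apply: val_inj.
Qed.

Lemma differentiable_row2 (V : normedModType K) (f g : V -> K) z :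
  differentiable f z -> differentiable g z ->
  differentiable (fun y => row2 (f y) (g y)) z.
Proof.
move=> df dg; have -> : (fun y => row2 (f y) (g y)) =
    (fun y => f y *: row2 1 0 + g y *: row2 0 1).
  by apply/funext => y; apply/rowP => j; rewrite !mxE; case: ifP => _; ring.
by apply: differentiableD; exact: differentiableZl.
Qed.

End Dilation.

Lemma near_comp (T U : topologicalType) (f : T -> U) (x : T) (y : U) (P : U -> Prop) :
  f x = y -> {for x, continuous f} -> (\forall u \near y, P u) -> \forall z \near x, P (f z).
Proof. by move=> <- fc Py; exact: fc. Qed.

Section NormalForm.
Context {K : numClosedFieldType}.
Local Notation bev p q := (p.[(q 0 0)%:P].[q 0 1]).

(** Put v = s k(s, t) where k is a square root of h / C. The function becomes
    C (v^2 + t^N), with C as the unit. Conversely s = v w(v, t), where w is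
    a root of w^2 h(v w, t) - C(v w, t). Both k and w come from [implicit_root], and
    its uniqueness part shows that w = 1 / k along corresponding points, so that the
    two maps are inverse to each other. *)
Lemma normal_form_iso (C h : {poly {poly K}}) (N : nat) :
  C.[0].[0] != 0 -> h.[0].[0] != 0 ->
  analytically_isomorphic
    (fun q : 'rV[K]_2 => q 0 1 ^+ N * bev C q + q 0 0 ^+ 2 * bev h q) 0
    (fun z : 'rV[K]_2 => z 0 0 ^+ 2 + z 0 1 ^+ N) 0.
Proof.
move=> C0 h0.
pose V := 'rV[K]_2.
have dc (j : 'I_2) (z : V) : differentiable (fun q : V => q 0 j) z by exact: differentiable_coord.
(* z = (v, t) for Phi, whose root is s / v, and z = (s, t) for Psi, whose root
   is v / s. *)
pose D := (2 + size h + size C)%N.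
pose Phi (z : V) : {poly K} := 'X^2 * dilate h (z 0 0) (z 0 1) - dilate C (z 0 0) (z 0 1).
have sizePhi z : (size (Phi z) <= D)%N.
  rewrite (leq_trans (size_polyD _ _)) // geq_max size_polyN.
  rewrite (leq_trans (size_polyMleq _ _)) ?size_polyXn ?(leq_trans (size_poly _ _)) //.
    by rewrite leq_addl.
  by rewrite (leq_trans _ (leq_addr _ _)) // (@leq_add 2 _ 2) // size_poly.
have diffPhi k z : differentiable (fun z => (Phi z)`_k) z.
  under eq_fun do rewrite coefB coefXnM.
  apply: differentiableB; last exact: differentiable_coef_dilate.
  case: (k < 2)%N; [exact: differentiable_cst|exact: differentiable_coef_dilate].
pose Psi (z : V) : {poly K} := (bev C z) *: 'X^2 - (bev h z)%:P.
have sizePsi z : (size (Psi z) <= 3)%N.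
  rewrite (leq_trans (size_polyD _ _)) // geq_max size_polyN.
  by rewrite (leq_trans (size_scale_leq _ _)) ?size_polyXn // (leq_trans (size_polyC_leq1 _)).
have diffPsi k z : differentiable (fun z => (Psi z)`_k) z.
  under eq_fun do rewrite coefB coefZ coefC.
  apply: differentiableB.
    by apply: differentiableM; [exact: differentiable_horner2|exact: differentiable_cst].
  case: (k == 0)%N; [exact: differentiable_horner2|exact: differentiable_cst].
have PhiE z w : (Phi z).[w] = w ^+ 2 * h.[(z 0 0 * w)%:P].[z 0 1] - C.[(z 0 0 * w)%:P].[z 0 1].
  by rewrite hornerD hornerN hornerM hornerXn !horner_dilate.
have PsiE z w : (Psi z).[w] = bev C z * w ^+ 2 - bev h z.
  by rewrite hornerD hornerN hornerC hornerZ hornerXn.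
pose w0 := sqrtC (C.[0].[0] / h.[0].[0]).
have w02 : w0 ^+ 2 = C.[0].[0] / h.[0].[0] by rewrite sqrtCK.
have w0N0 : w0 != 0 by rewrite sqrtC_eq0 mulf_neq0 ?invr_eq0.
have [om [om0 omd omr [e e0 omU]]] : exists om : V -> K,
    [/\ om 0 = w0, \forall z \near (0 : V), differentiable om z,
        \forall z \near (0 : V), root (Phi z) (om z)
      & exists2 e : K, 0 < e &
        \forall z \near (0 : V), forall w, `|w - w0| < e -> root (Phi z) w -> w = om z].
  apply: implicit_root sizePhi diffPhi _ _ _ _.
    by rewrite /root PhiE !mxE mul0r w02 divfK ?subrr.
  have -> : Phi 0 = h.[0].[0] *: 'X^2 - (C.[0].[0])%:P.
    rewrite /Phi !mxE; have dil0 p : dilate p 0 0 = (p.[0].[0] : K)%:P.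
      apply/polyP => i; rewrite coef_poly coefC; case: i => [|i] /=.
        by rewrite expr0 mul1r (horner_coef0 p); case: ltnP => // ?; rewrite nth_default // horner0.
      by rewrite expr0n /= mul0r if_same.
    by rewrite !dil0 mulrC mul_polyC.
  rewrite derivB derivC subr0 derivZ derivXn hornerZ hornerMn hornerXn expr1.
  by rewrite mulf_neq0 // -mulr_natr mulf_neq0 // pnatr_eq0.
have [ka [ka0 kad kar [e' e'0 kaU]]] : exists om : V -> K,
    [/\ om 0 = w0^-1, \forall z \near (0 : V), differentiable om z,
        \forall z \near (0 : V), root (Psi z) (om z)
      & exists2 e : K, 0 < e &
        \forall z \near (0 : V), forall w, `|w - w0^-1| < e -> root (Psi z) w -> w = om z].
  apply: implicit_root sizePsi diffPsi _ _ _ _.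
    by rewrite /root PsiE !mxE exprVn w02 invf_div mulrC divfK ?subrr.
  rewrite derivB derivC subr0 derivZ derivXn hornerZ hornerMn hornerXn expr1 !mxE.
  by rewrite mulf_neq0 // -mulr_natr mulf_neq0 ?invr_eq0 // pnatr_eq0.
pose phi (z : V) := row2 (z 0 0 * om z) (z 0 1).
pose psi (q : V) := row2 (q 0 0 * ka q) (q 0 1).
have phid : \forall z \near (0 : V), differentiable phi z.
  by apply: filterS omd => z dz; apply: differentiable_row2 => //; exact: differentiableM.
have psid : \forall z \near (0 : V), differentiable psi z.
  by apply: filterS kad => z dz; apply: differentiable_row2 => //; exact: differentiableM.
have phi0 : phi 0 = 0 by rewrite /phi !mxE mul0r; apply/rowP => j; rewrite !mxE; case: ifP.
have psi0 : psi 0 = 0 by rewrite /psi !mxE mul0r; apply/rowP => j; rewrite !mxE; case: ifP.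
have phic : {for (0 : V), continuous phi}.
  by apply: differentiable_continuous; exact: nbhs_singleton phid.
have psic : {for (0 : V), continuous psi}.
  by apply: differentiable_continuous; exact: nbhs_singleton psid.
have omc : {for (0 : V), continuous om}.
  by apply: differentiable_continuous; exact: nbhs_singleton omd.
have kac : {for (0 : V), continuous ka}.
  by apply: differentiable_continuous; exact: nbhs_singleton kad.
have omN0 : \forall z \near (0 : V), om z != 0.
  by have h1 : om 0 != 0; [rewrite om0|exact: cvgr_neq0 omc h1].
have kaN0 : \forall z \near (0 : V), ka z != 0.
  by have h1 : ka 0 != 0; [rewrite ka0 invr_eq0|exact: cvgr_neq0 kac h1].
exists phi, psi, (fun z => bev C (phi z)); split; split=> //.
- have kaV : \forall q \near (0 : V), `|(om q)^-1 - w0^-1| < e'.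
    have : (om q)^-1 @[q --> (0 : V)] --> w0^-1 
      by have h1 : om 0 != 0; [rewrite om0|rewrite -om0; exact: (cvgV h1 omc)].
    by move/cvgr_dist_lt => /(_ _ e'0); apply: filterS => q; rewrite distrC.
  have kaU' := near_comp phi0 phic kaU; near=> z.
  have kz : forall w, `|w - w0^-1| < e' -> root (Psi (phi z)) w -> w = ka (phi z) by near: z.
  have oz : `|(om z)^-1 - w0^-1| < e' by near: z.
  have oN : om z != 0 by near: z.
  have rz : root (Phi z) (om z) by near: z.
  rewrite /root PhiE in rz.
  rewrite [psi (phi z)]/psi; have <- := kz _ oz.
    by rewrite /psi /phi row2E0 row2E1 mulfK ?row2K.
  rewrite /root PsiE /phi row2E0 row2E1.
  move/eqP/subr0_eq: rz => <-; rewrite mulrAC -exprMn mulfV // expr1n mul1r subrr //.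
- have omV : \forall q \near (0 : V), `|(ka q)^-1 - w0| < e.
    have : (ka q)^-1 @[q --> (0 : V)] --> w0.
      by have h1 : ka 0 != 0; [rewrite ka0 invr_eq0|rewrite -[w0]invrK -ka0; exact: (cvgV h1 kac)].
    by move/cvgr_dist_lt => /(_ _ e0); apply: filterS => q; rewrite distrC.
  have omU' := near_comp psi0 psic omU; near=> z.
  have kz : forall w, `|w - w0| < e -> root (Phi (psi z)) w -> w = om (psi z) by near: z.
  have oz : `|(ka z)^-1 - w0| < e by near: z.
  have oN : ka z != 0 by near: z.
  have rz : root (Psi z) (ka z) by near: z.
  rewrite /root PsiE in rz.
  rewrite [phi (psi z)]/phi; have <- := kz _ oz.
    by rewrite /phi /psi row2E0 row2E1 mulfK ?row2K.
  rewrite /root PhiE /psi row2E0 row2E1 mulfK //.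
  by move/eqP/subr0_eq: rz => <-; rewrite mulrCA -exprMn mulVf // expr1n mulr1 subrr.
- apply: filterS phid => z dz.
  by apply: differentiable_horner2; exact: (differentiable_comp dz (dc _ _)).
- by rewrite phi0 !mxE.
- apply: filterS omr => z; rewrite /root PhiE => /eqP/subr0_eq rz.
  by rewrite /phi row2E0 row2E1 exprMn -mulrA rz; ring.
Unshelve. all: by end_near. Qed.
End NormalForm.

(** * The splitting lemma *)

(** Transport of a germ along a global change of coordinates [A] with inverse [B]. *)
Lemma analytically_isomorphic_comp (K : numFieldType) (A B : 'rV[K]_2 -> 'rV[K]_2)
    (F H G : 'rV[K]_2 -> K) (p q r : 'rV[K]_2) :
  (forall z, differentiable A z) -> (forall z, differentiable B z) ->
  cancel A B -> cancel B A -> A q = p -> (forall z, F (A z) = H z) ->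
  analytically_isomorphic H q G r -> analytically_isomorphic F p G r.
Proof.
move=> dA dB AK BK Aq FA [phi [psi [u [[phir dphi dpsi psiK phiK] [du u0 Hu]]]]].
have Bp : B p = q by rewrite -Aq AK.
have Bc : {for p, continuous B} by apply: differentiable_continuous; exact: dB.
exists (A \o phi), (psi \o B), u; split; split=> //=; first by rewrite phir.
- by apply: filterS dphi => z dz; exact: differentiable_comp.
- apply: filterS (near_comp Bp Bc dpsi) => z dz; exact: differentiable_comp.
- by apply: filterS psiK => z psiK; rewrite AK.
- by apply: filterS (near_comp Bp Bc phiK) => z /= ->; rewrite BK.
- by apply: filterS Hu => z; rewrite FA.
Qed.

Lemma taylor2 (R : comNzRingType) (G : {poly R}) (a : R) :
  exists2 h : {poly R}, h.[0] *+ 2 = G^`(2).[a] &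
    forall s, G.[a + s] = G.[a] + G^`().[a] * s + h.[s] * s ^+ 2.
Proof.
pose P := G \Po ('X + a%:P).
have dP (Q : {poly R}) : (Q \Po ('X + a%:P))^`() = Q^`() \Po ('X + a%:P).
  by rewrite deriv_comp derivD derivX derivC addr0 mulr1.
have PE (Q : {poly R}) s : (Q \Po ('X + a%:P)).[s] = Q.[a + s] by rewrite horner_comp !hornerE addrC.
exists (drop_poly 2 P).
  have <- : P^`(2).[0] = G^`(2).[a] by rewrite !derivnS !derivn0 !dP PE addr0.
  by rewrite !horner_coef0 coef_drop_poly coef_derivn addn0.
move=> s; rewrite -PE -/P -[in LHS](poly_take_drop 2 P) hornerD hornerM hornerXn; congr (_ + _).
have -> : take_poly 2 P = (G.[a])%:P + (G^`().[a])%:P * 'X.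
  apply/polyP => i; rewrite coef_take_poly coefD coefMX !coefC.
  case: i => [|[|i]] //=.
  - by rewrite addr0 -horner_coef0 PE addr0.
  - have <- : P^`().[0] = G^`().[a] by rewrite dP PE addr0.
    by rewrite horner_coef0 coef_deriv mulr1n add0r.
  - by rewrite addr0.
by rewrite !hornerE.
Qed.

Lemma horner2_horner (R : comNzRingType) (p : {poly {poly R}}) (T : {poly R}) (x : R) :
  p.[T].[x] = p.[T.[x], x].
Proof.
rewrite !(horner_coef p) !horner_sum; apply: eq_bigr => i _.
by rewrite !hornerM !horner_exp hornerC.
Qed.

Section Splitting.
Context {K : numClosedFieldType}.
Implicit Types (G Q : {poly {poly K}}) (T : {poly K}).

Lemma dvdXP (p : {poly K}) : reflect (p.[0] = 0) ('X %| p).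
Proof. by rewrite -['X]subr0 -polyC0 dvdp_XsubCl; exact: rootP. Qed.

(** Newton iteration one order at a time: adding c X^n changes Q(T) by
    c Q'(T) X^n up to higher order. *)
Lemma hensel Q n : Q.[0].[0] = 0 -> Q^`().[0].[0] != 0 ->
  exists2 T, T.[0] = 0 & 'X^n %| Q.[T].
Proof.
move=> Q0 Q'0; elim: n => [|n [T T0 QT]].
  by exists 0; rewrite ?horner0 // expr0 dvd1p.
case: n QT => [|n] QT.
  by exists 0; rewrite ?horner0 // expr1; apply/dvdXP; rewrite Q0.
have [q def_q] := dvdpP _ _ QT.
(* This c cancels the coefficient of X^(n+1) in Q(T + c X^(n+1)). *)
pose c := - q.[0] / Q^`().[0].[0].
exists (T + c%:P * 'X^(n.+1)); first by rewrite !hornerE T0 expr0n mulr0 addr0.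
have [h _ ->] := taylor2 Q T.
have -> : Q.[T] + Q^`().[T] * (c%:P * 'X^(n.+1)) + h.[c%:P * 'X^(n.+1)] * (c%:P * 'X^(n.+1)) ^+ 2 =
   (q + Q^`().[T] * c%:P + h.[c%:P * 'X^(n.+1)] * c%:P ^+ 2 * 'X^(n.+1)) * 'X^(n.+1).
  by rewrite def_q; ring.
rewrite [in X in X %| _]exprSr [X in X %| _]mulrC dvdp_mul //; apply/dvdXP.
rewrite !hornerE horner2_horner T0 expr0n /= mulr0 addr0.
by rewrite polyC0 mulrAC mulfV // mul1r subrr.
Qed.

(** With T given by [hensel], the term F_s(T, t) s of the expansion at T has order n
    in t, hence is absorbed by F(T, t) = c t^N as soon as N < n. *)
Lemma splitting G n :
  'X^2 %| G.[0] -> G^`().[0].[0] = 0 -> G^`(2).[0].[0] != 0 ->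
  (forall T, T.[0] = 0 -> 'X^n %| G^`().[T] -> 'X^n %| G.[T] -> False) ->
  exists m, [/\ (1 <= m)%N, (m.+1 < n)%N &
    analytically_isomorphic (fun q : 'rV[K]_2 => G.[q 0 0, q 0 1]) 0
      (fun z : 'rV[K]_2 => z 0 0 ^+ 2 + z 0 1 ^+ m.+1) 0].
Proof.
move=> G0 G'0 G''0 notflat.
have [T T0 dG'] : exists2 T, T.[0] = 0 & 'X^n %| G^`().[T].
  by apply: hensel => //; rewrite derivnS derivn1 in G''0.
have notdvd : ~~ ('X^n %| G.[T]) by apply/negP => dG; exact: notflat T0 dG' dG.
have GT0 : G.[T] != 0 by apply: contraNneq notdvd => ->; exact: dvdp0.
have [N [c]] := multiplicity_XsubC G.[T] 0; rewrite GT0 /= subr0 => c0 GTc.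
have Nn : (N < n)%N.
  by rewrite ltnNge; apply: contra notdvd => nN; rewrite GTc dvdp_mull // dvdp_exp2l.
have N2 : (2 <= N)%N.
  have : 'X^2 %| G.[T].
    have [h _] := taylor2 G 0; move/(_ T); rewrite add0r => ->.
    apply: dvdp_add; last by rewrite dvdp_mull // dvdp_exp2r //; exact/dvdXP.
    by apply: dvdp_add => //; rewrite expr2 dvdp_mul //; exact/dvdXP.
  rewrite GTc Gauss_dvdpr; last by rewrite coprimep_sym coprimep_expr // coprimepX.
  by rewrite dvdp_Pexp2l ?size_polyX.
have [r def_r] := dvdpP _ _ dG'.
have [h h2 taylor] := taylor2 G T.
pose C := c%:P + (r * 'X^(n - N))%:P * 'X.
exists N.-1; rewrite prednK ?(leq_trans _ N2) //; split => //.
  by rewrite -ltnS prednK // (leq_trans _ N2).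
apply: (@analytically_isomorphic_comp _ (fun z => row2 (T.[z 0 1] + z 0 0) (z 0 1))
   (fun q => row2 (q 0 0 - T.[q 0 1]) (q 0 1)) _
   (fun q : 'rV[K]_2 => q 0 1 ^+ N * C.[q 0 0, q 0 1] + q 0 0 ^+ 2 * h.[q 0 0, q 0 1]) _ _ 0).
- move=> z; apply: differentiable_row2; last exact: differentiable_coord.
  by apply: differentiableD; [apply: differentiable_horner|]; exact: differentiable_coord.
- move=> z; apply: differentiable_row2; last exact: differentiable_coord.
  by apply: differentiableB; [|apply: differentiable_horner]; exact: differentiable_coord.
- by move=> z; rewrite !row2E0 !row2E1 addrAC subrr add0r row2K.
- by move=> z; rewrite !row2E0 !row2E1 addrC subrK row2K.
- by rewrite !mxE T0 addr0 -[RHS]row2K !mxE.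
- move=> z; rewrite !row2E0 !row2E1.
  have -> : G.[T.[z 0 1] + z 0 0, z 0 1] = G.[T + (z 0 0)%:P].[z 0 1].
    by rewrite [RHS]horner2_horner hornerD hornerC.
  have Xn : 'X^n = 'X^(n - N) * 'X^N :> {poly K} by rewrite -exprD subnK // ltnW.
  rewrite taylor GTc def_r Xn /C !(hornerD, hornerM, hornerC, hornerX, hornerXn, horner_exp); ring.
- apply: normal_form_iso.
  + by rewrite /C !hornerE.
  + have : G^`(2).[T].[0] != 0 by rewrite horner2_horner T0.
    by rewrite -h2 hornerMn -mulr_natr mulf_eq0 negb_or => /andP[].
Qed.
End Splitting.

(** * Orders of vanishing and curves of critical points *)

Section FlatCurves.
Context {K : numClosedFieldType}.
Implicit Types p q x y u v : {poly K}.

Lemma dvdpZ (c : K) p q : q %| p -> q %| c *: p.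
Proof. by rewrite -mul_polyC; exact: dvdp_mull. Qed.

(** The X-adic order of a product is the sum of the orders. *)
Lemma dvdXn_mul a b p q : 'X^(a + b) %| p * q -> 'X^a %| p \/ 'X^b %| q.
Proof.
have [->|p0] := eqVneq p 0; first by left; exact: dvdp0.
have [m [c]] := multiplicity_XsubC p 0; rewrite p0 /= subr0 => c0 ->.
have [am|ma] := leqP a m; first by left; rewrite dvdp_mull // dvdp_exp2l.
rewrite -mulrA mulrCA -(subnKC (ltnW ma)) -addnA exprD dvdp_mul2l ?expf_neq0 ?polyX_eq0 //.
rewrite Gauss_dvdpr; last by rewrite coprimep_sym coprimep_expr // coprimepX.
by move=> h; right; apply: dvdp_trans h; rewrite dvdp_exp2l // leq_addl.
Qed.

Lemma dvdXn_mul_prod k q (s : seq {poly K}) :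
  'X^(k * (size s).+1) %| q * \prod_(p <- s) p ->
  'X^k %| q \/ exists2 p, p \in s & 'X^k %| p.
Proof.
elim: s => [|p s IH]; first by rewrite big_nil mulr1 muln1; left.
rewrite big_cons mulrCA mulnS => /dvdXn_mul[kp|/IH[|[r rs kr]]]; last 2 first.
- by left.
- by right; exists r; rewrite // inE rs orbT.
- by right; exists p; rewrite ?mem_head.
Qed.

Lemma dvdXn_exp_mul k n p q :
  'X^(k * n.+1) %| p ^+ n * q -> 'X^k %| p \/ 'X^k %| q.
Proof.
elim: n => [|n IH]; first by rewrite expr0 mul1r muln1; right.
by rewrite exprS -mulrA mulnS => /dvdXn_mul[|/IH]; [left|].
Qed.

Lemma dvdXn_deriv n p : 'X^(n.+1) %| p -> 'X^n %| p^`().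
Proof.
move=> /dvdpP[q ->]; rewrite derivM derivXn /= dvdp_add //.
  by rewrite dvdp_mull // dvdp_exp2l.
by rewrite mulrnAr -mulrnAl dvdp_mull.
Qed.

Lemma dvdXn_deriv_subC n p c : 'X^(n.+1) %| p - c%:P -> 'X^n %| p^`().
Proof. by move=> /dvdXn_deriv; rewrite derivB derivC subr0. Qed.

Variables a1 b1 c1 a2 b2 c2 : K.
Hypotheses (b1N0 : b1 != 0) (a2N0 : a2 != 0) (b2N0 : b2 != 0) (c2N0 : c2 != 0)
  (acN0 : a1 * c2 - a2 * c1 != 0).
Variable e : nat.
Local Notation D := e.+2.

(* On a curve along which the partial derivatives vanish, delta u^D = Pu(x) and
   delta v^D = Pv(x), while b2 u - b1 v = L(x) identically. *)
Let Pu : {poly K} := (a2%:P - c2 *: 'X^D).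
Let Pv : {poly K} := (c1 *: 'X^D - a1%:P).
Let L : {poly K} := (a1 * b2 - a2 * b1) *: 'X + (c1 * b2 - c2 * b1)%:P.
(* M comes from differentiating the first two relations, eliminating v and v' by
   the third one, which leaves x' (Pu E1 - b2 u W) = 0, and then removing u by
   taking D-th powers. *)
Let W := Pv * Pu^`() - Pu * Pv^`().
Let delta := a1 * c2 - a2 * c1.
Let E1 := (D%:R * (a1 * b2 - a2 * b1)) *: Pv - Pv^`() * L.
Let M : {poly K} := delta *: (Pu * E1) ^+ D - (b2 ^+ D) *: (Pu * W ^+ D).

Lemma elim_poly_neq0 : M != 0.
Proof.
(* M is Pu times a factor that does not vanish at the roots of Pu, because Pu
   has simple roots and no root in common with Pv. *)
have [r rd] : exists r, r ^+ D = a2 / c2.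
  by exists (D.-root (a2 / c2)); rewrite rootCK.
have rN0 : r != 0.
  have : r ^+ D != 0 by rewrite rd mulf_neq0 ?invr_eq0.
  by rewrite expf_eq0.
have Pur : Pu.[r] = 0.
  by rewrite hornerD hornerN hornerZ hornerC hornerXn rd mulrC divfK ?subrr.
have Pvr : Pv.[r] = - delta / c2.
  by rewrite hornerD hornerN hornerZ hornerC hornerXn rd /delta; field.
have Pu'r : Pu^`().[r] = - (c2 * (r ^+ e.+1 *+ D)).
  by rewrite derivB derivC sub0r derivZ derivXn hornerN hornerZ hornerMn hornerXn.
have Pu'N0 : Pu^`().[r] != 0.
  by rewrite Pu'r oppr_eq0 mulf_neq0 // mulrn_eq0 negb_or expf_neq0.
have Wr : W.[r] != 0.
  rewrite hornerD hornerN !hornerM Pur mul0r subr0 Pvr.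
  by rewrite !mulf_neq0 ?oppr_eq0 ?invr_eq0.
have -> : M = Pu * (delta *: (Pu ^+ e.+1 * E1 ^+ D) - (b2 ^+ D) *: W ^+ D).
  by rewrite /M exprMn (exprS Pu e.+1) -!mul_polyC; ring.
rewrite mulf_neq0 //.
  by apply: contraNneq Pu'N0 => Pu0; rewrite Pu0 derivC horner0.
apply: contraNneq Wr => /(congr1 (fun p : {poly K} => p.[r])).
rewrite horner0 hornerD hornerN !hornerZ hornerM !horner_exp Pur expr0n mul0r mulr0 sub0r.
move/eqP; rewrite oppr_eq0 -exprMn expf_eq0 /= mulf_eq0 (negbTE b2N0) => /eqP ->.
by [].
Qed.

Lemma delta_u_congr x y :
  let u := a1 *: x + b1 *: y + c1%:P in let v := a2 *: x + b2 *: y + c2%:P in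
  forall q, q %| x ^+ D + a1 *: u ^+ D + a2 *: v ^+ D ->
  q %| 1 + c1 *: u ^+ D + c2 *: v ^+ D ->
  q %| delta *: u ^+ D - (Pu \Po x).
Proof.
move=> u v q fx fz.
have -> : delta *: u ^+ D - (Pu \Po x) = c2 *: (x ^+ D + a1 *: u ^+ D + a2 *: v ^+ D) -
    a2 *: (1 + c1 *: u ^+ D + c2 *: v ^+ D).
  rewrite /Pu comp_polyB comp_polyC comp_polyZ comp_Xn_poly /delta -!mul_polyC; ring.
by apply: dvdp_sub; apply: dvdpZ.
Qed.

(** Multiplying the derivatives of the first two relations by u and v removes the
    powers: D Pu u' = Pu' x' u and D Pv v' = Pv' x' v. Their combination with the
    derivative of the third relation is x' (Pu E1 - b2 u W) = 0, which divides
    x' ((Pu E1)^D - (b2 u W)^D); and delta u^D = Pu. *)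
Lemma elim_poly_dvd x y :
  let u := a1 *: x + b1 *: y + c1%:P in let v := a2 *: x + b2 *: y + c2%:P in
  forall n, 'X^(n.+1) %| x ^+ D + a1 *: u ^+ D + a2 *: v ^+ D ->
  'X^(n.+1) %| 1 + c1 *: u ^+ D + c2 *: v ^+ D ->
  'X^n %| x^`() * (M \Po x).
Proof.
move=> u v n fx fz.
pose pu := Pu \Po x; pose pv := Pv \Po x; pose pu' := Pu^`() \Po x; pose pv' := Pv^`() \Po x.
have hu : 'X^(n.+1) %| delta *: u ^+ D - pu := delta_u_congr fx fz.
have hv : 'X^(n.+1) %| delta *: v ^+ D - pv.
  have -> : delta *: v ^+ D - pv = a1 *: (1 + c1 *: u ^+ D + c2 *: v ^+ D) -
      c1 *: (x ^+ D + a1 *: u ^+ D + a2 *: v ^+ D).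
    rewrite /pv /Pv comp_polyB comp_polyC comp_polyZ comp_Xn_poly /delta -!mul_polyC; ring.
  by apply: dvdp_sub; apply: dvdpZ.
have hu' : 'X^n %| D%:R *: (pu * u^`()) - pu' * x^`() * u.
  have -> : D%:R *: (pu * u^`()) - pu' * x^`() * u =
     u * (delta *: u ^+ D - pu)^`() - (D%:R *: u^`()) * (delta *: u ^+ D - pu).
    rewrite derivB derivZ deriv_exp deriv_comp -/pu' /= (exprS u e.+1) -!mul_polyC.
    by rewrite polyCMn -mulr_natl; ring.
  apply: dvdp_sub; first by rewrite dvdp_mull // dvdXn_deriv.
  by rewrite dvdp_mull // (dvdp_trans _ hu) // dvdp_exp2l.
have hv' : 'X^n %| D%:R *: (pv * v^`()) - pv' * x^`() * v.
  have -> : D%:R *: (pv * v^`()) - pv' * x^`() * v =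
     v * (delta *: v ^+ D - pv)^`() - (D%:R *: v^`()) * (delta *: v ^+ D - pv).
    rewrite derivB derivZ deriv_exp deriv_comp -/pv' /= (exprS v e.+1) -!mul_polyC.
    by rewrite polyCMn -mulr_natl; ring.
  apply: dvdp_sub; first by rewrite dvdp_mull // dvdXn_deriv.
  by rewrite dvdp_mull // (dvdp_trans _ hv) // dvdp_exp2l.
pose l := L \Po x.
have lE : b2 *: u - b1 *: v = l.
  by rewrite /l comp_polyD comp_polyC comp_polyZ comp_polyX /u /v -!mul_polyC; ring.
have lE' : b2 *: u^`() - b1 *: v^`() = (a1 * b2 - a2 * b1) *: x^`().
  by rewrite /u /v !derivD !derivZ !derivC !addr0 -!mul_polyC; ring.
pose w := W \Po x; pose e1 := E1 \Po x.
have hk : 'X^n %| x^`() * (pu * e1 - b2 *: (u * w)).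
  have -> : x^`() * (pu * e1 - b2 *: (u * w)) =
    b2 *: (pv * (D%:R *: (pu * u^`()) - pu' * x^`() * u))
    - b1 *: (pu * (D%:R *: (pv * v^`()) - pv' * x^`() * v)).
    have e1E : e1 = (D%:R * (a1 * b2 - a2 * b1)) *: pv - pv' * l.
      by rewrite /e1 comp_polyB comp_polyZ comp_polyM.
    have wE : w = pv * pu' - pu * pv' by rewrite /w comp_polyB !comp_polyM.
    have -> : b1 *: (pu * (D%:R *: (pv * v^`()) - pv' * x^`() * v)) =
        pu * (D%:R *: (pv * (b1 *: v^`())) - pv' * x^`() * (b1 *: v)).
      by rewrite -!mul_polyC; ring.
    have -> : b1 *: v = b2 *: u - l by rewrite -lE opprB addrC subrK.
    have -> : b1 *: v^`() = b2 *: u^`() - (a1 * b2 - a2 * b1) *: x^`().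
      by rewrite -lE' opprB addrC subrK.
    by rewrite e1E wE -!mul_polyC; ring.
  by apply: dvdp_sub; apply: dvdpZ; apply: dvdp_mull.
have hM : M \Po x = delta *: ((pu * e1) ^+ D - (b2 *: (u * w)) ^+ D)
    + (b2 ^+ D *: w ^+ D) * (delta *: u ^+ D - pu).
  have cX p k : (p ^+ k) \Po x = (p \Po x) ^+ k.
    by elim: k => [|k IH]; rewrite ?expr0 ?comp_polyC // !exprS comp_polyM IH.
  rewrite /M comp_polyB !comp_polyZ cX (comp_polyM Pu E1) (comp_polyM Pu (W ^+ D)) cX -/pu -/e1 -/w.
  rewrite exprZn (exprMn _ u w) -!mul_polyC; ring.
rewrite hM mulrDr dvdp_add //; last first.
  by rewrite !dvdp_mull // (dvdp_trans _ hu) // dvdp_exp2l.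
by rewrite subrXX -scalerAr mulrA dvdpZ // dvdp_mulr.
Qed.

(** No curve with a nonzero tangent vector at 0 kills the partial derivatives to
    high order. The product of x' and M(x) has high order, so x' or one of the
    x - r has order at least k, and in both cases x' has high order. Then so has
    the derivative of u^D, which forces u'(0) = 0, and y is a combination
    of x, u and a constant. *)
Lemma no_flat_curve : exists n, forall x y,
  let u := a1 *: x + b1 *: y + c1%:P in let v := a2 *: x + b2 *: y + c2%:P in
  'X^n %| x ^+ D + a1 *: u ^+ D + a2 *: v ^+ D ->
  'X^n %| 1 + c1 *: u ^+ D + c2 *: v ^+ D ->
  x^`().[0] = 0 /\ y^`().[0] = 0.
Proof.
have [rs def_M] := closed_field_poly_normal M.
(* The factors of x' M(x) are x' and the x - r for the roots r of M. The order k
   leaves order 2 for u or u' once the D factors of u^(D-1) u' are separated. *)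
pose k := (2 * e.+2).+1.
exists (k * (size rs).+1).+1 => x y u v fx fz.
have := elim_poly_dvd fx fz; rewrite def_M linearZ /= rmorph_prod /= -/u -/v.
rewrite -scalerAr dvdpZr ?lead_coef_eq0 ?elim_poly_neq0 //.
rewrite -[\prod_(i <- rs) _](big_map (fun r => ('X - r%:P) \Po x) xpredT id).
rewrite -(size_map (fun r => ('X - r%:P) \Po x)) => /dvdXn_mul_prod xk.
have {xk} x' : 'X^(2 * e.+2) %| x^`().
  case: xk => [|[_ /mapP[r _ ->]]]; first by apply: dvdp_trans; rewrite dvdp_exp2l.
  by rewrite comp_polyB comp_polyX comp_polyC; exact: dvdXn_deriv_subC.
have u' : 'X %| u^`().
  have : 'X^(2 * e.+2) %| u ^+ e.+1 * u^`().
    have := dvdXn_deriv (delta_u_congr fx fz); rewrite -/u.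
    move=> /(dvdp_trans (dvdp_exp2l 'X (leq_pmulr _ (ltn0Sn (size rs))))).
    move=> /(dvdp_trans (dvdp_exp2l 'X (leqnSn _))).
    rewrite derivB derivZ deriv_exp deriv_comp /= -/k.
    rewrite dvdp_subl; last by rewrite dvdp_mull.
    by rewrite -scaler_nat !dvdpZr ?pnatr_eq0 // mulrC.
  move=> /dvdXn_exp_mul[|].
    by move=> /dvdXn_deriv.
  by apply: dvdp_trans; rewrite -{1}['X]expr1 dvdp_exp2l.
have x'0 : x^`().[0] = 0.
  by apply/dvdXP; apply: dvdp_trans x'; rewrite -{1}['X]expr1 dvdp_exp2l.
split => //; move/dvdXP : u'.
rewrite /u !derivD !derivZ derivC addr0 hornerD !hornerZ x'0 mulr0 add0r => /eqP.
by rewrite mulf_eq0 (negbTE b1N0) => /eqP.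
Qed.

End FlatCurves.

(** * Singularities of sums of powers *)

Section PowerSumGerm.
Context {K : numClosedFieldType}.
Variables (r e : nat) (al be ga : 'I_r -> K).

(** The sum of the powers of al + be s + ga t, as a polynomial in s over the
    polynomials in t. *)
Definition germ_poly : {poly {poly K}} :=
  \sum_j ((be j)%:P *: 'X + ((al j)%:P + ga j *: 'X)%:P) ^+ e.+2.

Lemma germ_polyE (T : {poly K}) :
  germ_poly.[T] = \sum_j ((al j)%:P + be j *: T + ga j *: 'X) ^+ e.+2.
Proof.
rewrite horner_sum; apply: eq_bigr => j _.
by rewrite horner_exp hornerD hornerZ hornerX hornerC mul_polyC addrCA addrA.
Qed.

Lemma deriv_germ_polyE (T : {poly K}) : germ_poly^`().[T] =
  e.+2%:R *: \sum_j be j *: ((al j)%:P + be j *: T + ga j *: 'X) ^+ e.+1.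
Proof.
rewrite raddf_sum horner_sum scaler_sumr; apply: eq_bigr => j _.
rewrite /= deriv_exp derivD derivZ derivC derivX addr0 alg_polyC /= hornerMn hornerM.
rewrite hornerC horner_exp hornerD hornerZ hornerX hornerC !mul_polyC scaler_nat.
by rewrite addrCA addrA.
Qed.

Lemma deriv2_germ_polyE : germ_poly^`(2).[0].[0] =
  (e.+2 * e.+1)%:R * \sum_j be j ^+ 2 * al j ^+ e.
Proof.
rewrite derivnS derivn1 !raddf_sum !horner_sum mulr_sumr; apply: eq_bigr => j _ /=.
have dB (b c : {poly K}) : (b *: 'X + c%:P)^`() = b%:P.
  by rewrite derivD derivZ derivC derivX addr0 alg_polyC.
rewrite deriv_exp dB derivMn deriv_mulC deriv_exp dB /=.
rewrite !(hornerMn, hornerM, hornerC, horner_exp, hornerD, hornerZ, hornerX).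
rewrite !mulr0 !(add0r, addr0) natrM -[_ *+ e.+1]mulr_natr -[_ *+ e.+2]mulr_natr; ring.
Qed.

End PowerSumGerm.

Section PowerSumChart.
Context {K : numClosedFieldType}.
Variables (r e n : nat) (al be ga : 'I_r -> K).

(** The plane is parametrized around p by the basis (v, v') of the chart. The
    hypotheses on the sums say that the germ is singular, with nonzero second
    derivative along v, and the last one excludes that it is flat. *)
Lemma power_sum_type_A (f : mpoly 3 K) (p : 'rV[K]_3) (i : 'I_3) (v v' : 'rV[K]_2) :
  p 0 i != 0 -> v 0 0 * v' 0 1 - v 0 1 * v' 0 0 != 0 ->
  (forall s t, ev f (chart i (chart_coord i p + s *: v + t *: v')) =
     \sum_j (al j + s * be j + t * ga j) ^+ e.+2) ->
  \sum_j al j ^+ e.+2 = 0 -> \sum_j be j * al j ^+ e.+1 = 0 ->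
  \sum_j ga j * al j ^+ e.+1 = 0 -> \sum_j be j ^+ 2 * al j ^+ e != 0 ->
  (forall T : {poly K}, T.[0] = 0 ->
     let X j := (al j)%:P + be j *: T + ga j *: 'X in
     'X^n %| \sum_j be j *: X j ^+ e.+1 -> 'X^n %| \sum_j X j ^+ e.+2 -> False) ->
  exists m, [/\ (1 <= m)%N, (m.+1 < n)%N & type_A m f p].
Proof.
move=> pi det fE f0 fs ft fss notflat.
have [||||m [m1 mn iso]] := @splitting K (germ_poly e al be ga) n.
- rewrite germ_polyE.
  have h : 'X %| (\sum_j ((al j)%:P + be j *: 0 + ga j *: 'X) ^+ e.+2 : {poly K}).
    apply/dvdXP; rewrite horner_sum -[RHS]f0; apply: eq_bigr => j _.
    by rewrite horner_exp !hornerD !hornerZ hornerC hornerX horner0 !mulr0 !addr0.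
  have [q def_q] := dvdpP _ _ h; rewrite def_q expr2 dvdp_mul2r ?polyX_eq0 //.
  apply/dvdXP; have : (q * 'X)^`().[0] = q.[0].
    by rewrite derivM derivX hornerD !hornerM hornerX hornerC mulr0 add0r mulr1.
  move=> <-; rewrite -def_q raddf_sum horner_sum /=.
  transitivity (e.+2%:R * \sum_j ga j * al j ^+ e.+1); last by rewrite ft mulr0.
  rewrite mulr_sumr.
  apply: eq_bigr => j _.
  rewrite /= deriv_exp !derivD derivC scaler0 derivC !add0r derivZ derivX alg_polyC /= hornerMn hornerM.
  by rewrite !addr0 horner_exp hornerD !hornerC hornerZ hornerX mulr0 addr0 mulr_natl.
- rewrite deriv_germ_polyE hornerZ horner_sum.
  transitivity (e.+2%:R * \sum_j be j * al j ^+ e.+1); last by rewrite fs mulr0.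
  congr (_ * _).
  apply: eq_bigr => j _.
  by rewrite hornerZ horner_exp !hornerD !hornerZ hornerC hornerX horner0 !mulr0 !addr0.
- by rewrite deriv2_germ_polyE mulf_neq0 // pnatr_eq0.
- move=> T T0; rewrite germ_polyE deriv_germ_polyE dvdpZr ?pnatr_eq0 //.
  exact: notflat.
exists m; split=> //; exists i => //.
pose q0 := chart_coord i p; set D := _ - _ in det.
have rD (u w : 'rV[K]_2) j : (u + w) 0 j = u 0 j + w 0 j by rewrite mxE.
have rN (u : 'rV[K]_2) j : (- u) 0 j = - u 0 j by rewrite mxE.
have rZ c (u : 'rV[K]_2) j : (c *: u) 0 j = c * u 0 j by rewrite mxE.
apply: (@analytically_isomorphic_comp _ (fun z => q0 + z 0 0 *: v + z 0 1 *: v')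
  (fun q => row2 (((q - q0) 0 0 * v' 0 1 - (q - q0) 0 1 * v' 0 0) / D)
                 ((v 0 0 * (q - q0) 0 1 - v 0 1 * (q - q0) 0 0) / D))
  _ _ _ _ 0 _ _ _ _ _ _ _ iso).
- move=> z; apply: differentiableD; last by apply: differentiableZl; exact: differentiable_coord.
  apply: differentiableD; first exact: differentiable_cst.
  by apply: differentiableZl; exact: differentiable_coord.
- have dq (j : 'I_2) z : differentiable (fun q : 'rV[K]_2 => (q - q0) 0 j) z.
    have -> : (fun q : 'rV[K]_2 => (q - q0) 0 j) = (fun q => q 0 j - q0 0 j).
      by apply/funext => q; rewrite !mxE.
    by apply: differentiableB; [exact: differentiable_coord|exact: differentiable_cst].
  have dc (c : K) z : differentiable ((fun=> c) : 'rV[K]_2 -> K) z by exact: differentiable_cst.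
  move=> z; apply: differentiable_row2; apply: differentiableM; try exact: dc.
    by apply: differentiableB; apply: differentiableM; first [exact: dq|exact: dc].
  by apply: differentiableB; apply: differentiableM; first [exact: dq|exact: dc].
- move=> z /=; rewrite -[RHS]row2K -(addrA q0) [q0 + _]addrC addrK.
  rewrite !(rD, rZ).
  by congr row2; rewrite /D; field.
- move=> q /=; rewrite row2E0 row2E1 -[LHS]row2K -[RHS]row2K.
  rewrite !(rD, rZ, rN).
  by congr row2; rewrite /D; field.
- by rewrite !mxE !scale0r !addr0.
- move=> z; rewrite /q0 fE germ_polyE horner_sum; apply: eq_bigr => j _.
  by rewrite horner_exp !hornerD !hornerZ !hornerC hornerX ![_ * z 0 _]mulrC.
Qed.
End PowerSumChart.

Lemma sum2 (R : nmodType) (F : 'I_2 -> R) : \sum_(l < 2) F l = F 0 + F 1.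
Proof. by rewrite !big_ord_recl big_ord0 addr0; congr (F _ + F _); apply: val_inj. Qed.

Section PowerSumSingularity.
Context {K : numClosedFieldType}.
Variables (r e : nat) (L : 'I_r -> 'I_3 -> K).

Definition lin (j : 'I_r) (p : 'rV[K]_3) : K := \sum_k L j k * p 0 k.

Definition hess (p : 'rV[K]_3) (k l : 'I_3) : K :=
  \sum_j L j k * L j l * lin j p ^+ e.+1.

Lemma lin_chart j i (q : 'rV[K]_2) :
  lin j (chart i q) = L j i + \sum_(l < 2) L j (lift i l) * q 0 l.
Proof.
rewrite /lin (bigD1_ord i) //= /chart mxE unlift_none mulr1; congr (_ + _).
by apply: eq_bigr => l _; rewrite mxE liftK.
Qed.

Lemma sum_lift (R : nmodType) (i : 'I_3) (F : 'I_3 -> R) :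
  \sum_k F k = F i + (F (lift i 0) + F (lift i 1)).
Proof. by rewrite (bigD1_ord i) //= sum2. Qed.

Lemma lift_ind (i : 'I_3) (P : 'I_3 -> Prop) :
  P i -> P (lift i 0) -> P (lift i 1) -> forall k, P k.
Proof.
move=> Pi P0 P1 k; case: (unliftP i k) => [l ->|->] //; case: l => -[|[|//]] l2.
  by rewrite (_ : Ordinal l2 = 0) //; exact: val_inj.
by rewrite (_ : Ordinal l2 = 1) //; exact: val_inj.
Qed.

Lemma chart_chart_coord i (p : 'rV[K]_3) : p 0 i = 1 -> chart i (chart_coord i p) = p.
Proof.
move=> pi; apply/rowP => k; rewrite !mxE.
by case: unliftP => [l ->|->]; rewrite ?mxE pi // divr1.
Qed.

(** Polarization: a symmetric form that vanishes on both coordinate vectors and on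
    their sum is zero. *)
Lemma nonzero_direction (h00 h01 h11 : K) :
  [|| h00 != 0, h01 != 0 | h11 != 0] ->
  exists v v' : 'rV[K]_2, v 0 0 * v' 0 1 - v 0 1 * v' 0 0 != 0 /\
    v 0 0 ^+ 2 * h00 + v 0 0 * v 0 1 * h01 *+ 2 + v 0 1 ^+ 2 * h11 != 0.
Proof.
have [h0|h0 _] := eqVneq h00 0; last first.
  exists (row2 1 0), (row2 0 1); rewrite !row2E0 !row2E1; split.
    by rewrite mulr1 mulr0 subr0 oner_neq0.
  by rewrite expr1n mul1r mulr0 !mul0r expr0n /= mul0r mul0rn !addr0.
have [h1|h1 _] := eqVneq h11 0; last first.
  exists (row2 0 1), (row2 1 0); rewrite !row2E0 !row2E1; split.
    by rewrite mulr1 mul0r sub0r oppr_eq0 oner_neq0.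
  by rewrite expr1n expr0n /= !mul0r mul0rn !add0r mul1r.
rewrite /= orbF => h01N0; exists (row2 1 1), (row2 0 1); rewrite !row2E0 !row2E1; split.
  by rewrite mulr1 mulr0 subr0 oner_neq0.
by rewrite h0 h1 !mulr0 add0r addr0 !mul1r -mulr_natr mulf_neq0 // pnatr_eq0.
Qed.

(** If F_s and F vanish to high order along s = T(t), so do all the partial
    derivatives: F_t by differentiating F(T(t), t), and the homogeneous derivatives
    by inverting the change of basis (v, v') and by Euler's relation. Hence [curve]
    applies and makes the tangent vector T'(0) v + v' zero, against the
    independence of v and v'. *)
Lemma power_sum_singularity (f : mpoly 3 K) (p : 'rV[K]_3) (i : 'I_3) n :
  (forall P, ev f P = \sum_j lin j P ^+ e.+3) ->
  p 0 i = 1 -> (forall k, \sum_j L j k * lin j p ^+ e.+2 = 0) ->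
  (let h k l := hess p (lift i k) (lift i l) in
     [|| h 0 0 != 0, h 0 1 != 0 | h 1 1 != 0]) ->
  (forall x : 'I_3 -> {poly K}, x i = 1 ->
     (forall k, (x k).[0] = p 0 k) ->
     (forall k, 'X^n %| \sum_j L j k *: (\sum_l L j l *: x l) ^+ e.+2) ->
     forall k, (x k)^`().[0] = 0) ->
  exists m, [/\ (1 <= m)%N, (m <= n.-1)%N & type_A m f p].
Proof.
move=> fE pi grad hN0 curve.
have [v [v' [det hv]]] := nonzero_direction hN0.
pose al j := lin j p.
pose be j := \sum_l L j (lift i l) * v 0 l.
pose ga j := \sum_l L j (lift i l) * v' 0 l.
have lin_dir (w : 'rV[K]_2) : \sum_j (\sum_l L j (lift i l) * w 0 l) * al j ^+ e.+2 = 0.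
  under eq_bigr do rewrite sum2 mulrDl !(mulrAC _ (w 0 _)).
  by rewrite big_split /= -!mulr_suml !grad !mul0r addr0.
have [|||||||m [m1 mn tA]] := @power_sum_type_A K r e.+1 n.+1 al be ga f p i v v' _ det.
- by rewrite pi oner_neq0.
- move=> s t; rewrite fE; apply: eq_bigr => j _; congr (_ ^+ _).
  have alE : al j = L j i + \sum_l L j (lift i l) * chart_coord i p 0 l.
    by rewrite /al -{1}(chart_chart_coord pi) lin_chart.
  by rewrite lin_chart alE /be /ga !sum2 !mxE; ring.
- transitivity (\sum_k p 0 k * \sum_j L j k * al j ^+ e.+2).
    under [RHS]eq_bigr do rewrite mulr_sumr.
    rewrite exchange_big /=; apply: eq_bigr => j _; rewrite exprS {1}/al /lin mulr_suml.
    by apply: eq_bigr => k _; rewrite mulrA [p 0 k * _]mulrC.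
  by rewrite big1 // => k _; rewrite grad mulr0.
- exact: lin_dir.
- exact: lin_dir.
- have <- // : v 0 0 ^+ 2 * hess p (lift i 0) (lift i 0) +
      v 0 0 * v 0 1 * hess p (lift i 0) (lift i 1) *+ 2 +
      v 0 1 ^+ 2 * hess p (lift i 1) (lift i 1) = \sum_j be j ^+ 2 * al j ^+ e.+1.
  rewrite /hess -mulr_natr !mulr_sumr mulr_suml -!big_split /=.
  by apply: eq_bigr => j _; rewrite /be sum2 /al; ring.
- move=> T T0 X Xs X0.
  pose ext (w : 'rV[K]_2) k := if unlift i k is Some l then w 0 l else 0.
  pose x k : {poly K} := (p 0 k)%:P + ext v k *: T + ext v' k *: 'X.
  have xi : x i = 1 by rewrite /x /ext unlift_none !scale0r !addr0 pi.
  have xl l : x (lift i l) = (p 0 (lift i l))%:P + v 0 l *: T + v' 0 l *: 'X.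
    by rewrite /x /ext liftK.
  have XE j : X j = \sum_k L j k *: x k.
    rewrite (sum_lift i) xi !xl /X /al /be /ga /lin (sum_lift i) !sum2 pi mulr1.
    by rewrite -!mul_polyC; ring.
  pose F k := \sum_j L j k *: X j ^+ e.+2.
  have dX j : (X j)^`() = be j *: T^`() + (ga j)%:P.
    by rewrite /X !derivD derivC add0r !derivZ derivX alg_polyC.
  have gs : 'X^n %| \sum_j be j *: X j ^+ e.+2.
    by apply: dvdp_trans Xs; rewrite dvdp_exp2l.
  have gt : 'X^n %| \sum_j ga j *: X j ^+ e.+2.
    have := dvdXn_deriv X0.
    have -> : (\sum_j X j ^+ e.+3)^`() = e.+3%:R *:
       (T^`() * \sum_j be j *: X j ^+ e.+2 + \sum_j ga j *: X j ^+ e.+2).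
      rewrite raddf_sum mulr_sumr -big_split /= scaler_sumr; apply: eq_bigr => j _.
      by rewrite deriv_exp dX /= scaler_nat -!mul_polyC; congr (_ *+ _); ring.
    by rewrite dvdpZr ?pnatr_eq0 // dvdp_addr // dvdp_mull.
  have FE w : \sum_j (\sum_l L j (lift i l) * w 0 l) *: X j ^+ e.+2 =
      w 0 0 *: F (lift i 0) + w 0 1 *: F (lift i 1) :> {poly K}.
    rewrite /F !scaler_sumr -big_split /=; apply: eq_bigr => j _.
    by rewrite sum2 -!mul_polyC; ring.
  rewrite FE in gs; rewrite FE in gt.
  have F0 : 'X^n %| F (lift i 0).
    rewrite -(dvdpZr _ _ det).
    have -> : (v 0 0 * v' 0 1 - v 0 1 * v' 0 0) *: F (lift i 0) =
      v' 0 1 *: (v 0 0 *: F (lift i 0) + v 0 1 *: F (lift i 1)) -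
      v 0 1 *: (v' 0 0 *: F (lift i 0) + v' 0 1 *: F (lift i 1)).
      by rewrite -!mul_polyC; ring.
    by apply: dvdp_sub; exact: dvdpZ.
  have F1 : 'X^n %| F (lift i 1).
    rewrite -(dvdpZr _ _ det).
    have -> : (v 0 0 * v' 0 1 - v 0 1 * v' 0 0) *: F (lift i 1) =
      v 0 0 *: (v' 0 0 *: F (lift i 0) + v' 0 1 *: F (lift i 1)) -
      v' 0 0 *: (v 0 0 *: F (lift i 0) + v 0 1 *: F (lift i 1)).
      by rewrite -!mul_polyC; ring.
    by apply: dvdp_sub; exact: dvdpZ.
  have Fi : 'X^n %| F i.
    have : 'X^n %| \sum_k x k * F k.
      have -> : \sum_k x k * F k = \sum_j X j ^+ e.+3.
        under eq_bigr do rewrite mulr_sumr.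
        rewrite exchange_big /=; apply: eq_bigr => j _; rewrite [RHS]exprS {2}XE mulr_suml.
        by apply: eq_bigr => k _; rewrite -scalerAr -scalerAl.
      by apply: dvdp_trans X0; rewrite dvdp_exp2l.
    by rewrite (sum_lift i) xi mul1r dvdp_addl // dvdp_add // dvdp_mull.
  have x'0 : forall k, (x k)^`().[0] = 0.
    apply: curve => // [k|k].
      by rewrite !hornerD !hornerZ hornerC hornerX T0 !mulr0 !addr0.
    have -> : \sum_j L j k *: (\sum_l L j l *: x l) ^+ e.+2 = F k.
      by apply: eq_bigr => j _; rewrite XE.
    by move: k; exact: (lift_ind Fi F0 F1).
  have x'l l : v 0 l * T^`().[0] + v' 0 l = 0.
    have := x'0 (lift i l); rewrite xl !derivD derivC add0r !derivZ derivX alg_polyC.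
    by rewrite hornerD hornerZ hornerC.
  have v'E l : v' 0 l = - (v 0 l * T^`().[0]) by apply/eqP; rewrite -addr_eq0 addrC x'l.
  by move: det; rewrite !v'E => /eqP; apply; ring.
by exists m; split=> //; case: n {curve} mn => // n; rewrite ltnS.
Qed.
End PowerSumSingularity.

Lemma cramer2 (K : fieldType) (h00 h01 h11 a b : K) :
  h00 * h11 - h01 ^+ 2 != 0 -> h00 * a + h01 * b = 0 -> h01 * a + h11 * b = 0 ->
  a = 0 /\ b = 0.
Proof.
move=> det e0 e1; split; apply: (mulfI det); rewrite mulr0.
  by transitivity (h11 * (h00 * a + h01 * b) - h01 * (h01 * a + h11 * b));
    [ring|rewrite e0 e1 !mulr0 subr0].
by transitivity (h00 * (h01 * a + h11 * b) - h01 * (h00 * a + h01 * b));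
  [ring|rewrite e0 e1 !mulr0 subr0].
Qed.

Section Nondegenerate.
Context {K : numClosedFieldType}.
Variables (r e : nat) (L : 'I_r -> 'I_3 -> K).
Local Notation hess := (hess e L).
Local Notation lin := (lin L).

Lemma hessC p k l : hess p k l = hess p l k.
Proof. by apply: eq_bigr => j _; rewrite [L j k * _]mulrC. Qed.

(** If the gradient has order 2 along a curve, the tangent vector of the curve is in
    the kernel of the Hessian form. So curves of order 2 are excluded, which is the
    case n = 2 of the bound. *)
Lemma nondegenerate_type_A1 (f : mpoly 3 K) (p : 'rV[K]_3) (i : 'I_3) :
  (forall P, ev f P = \sum_j lin j P ^+ e.+3) ->
  p 0 i = 1 -> (forall k, \sum_j L j k * lin j p ^+ e.+2 = 0) ->
  (let h k l := hess p (lift i k) (lift i l) in h 0 0 * h 1 1 - h 0 1 ^+ 2 != 0) ->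
  type_A 1 f p.
Proof.
move=> fE pi grad det; rewrite /= in det.
have [||m [m1 m2 tA]] := power_sum_singularity (n := 2) fE pi grad; last first.
- by have -> : 1%N = m by apply/eqP; rewrite eqn_leq m1 m2.
- move=> x xi x0 xF k.
  have x'i : (x i)^`().[0] = 0 by rewrite xi derivC horner0.
  have hx m : \sum_l hess p m l * (x l)^`().[0] = 0.
    have := dvdXn_deriv (xF m); rewrite expr1 => /dvdXP.
    rewrite raddf_sum horner_sum /= => h0.
    suff : e.+2%:R * \sum_l hess p m l * (x l)^`().[0] = 0.
      by move/eqP; rewrite mulf_eq0 pnatr_eq0 => /eqP.
    rewrite -[RHS]h0 mulr_sumr /hess.
    transitivity (\sum_l \sum_j e.+2%:R * (L j m * L j l * lin j p ^+ e.+1 * (x l)^`().[0])).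
      by apply: eq_bigr => l _; rewrite mulr_suml mulr_sumr.
    rewrite exchange_big /=; apply: eq_bigr => j _.
    rewrite derivZ deriv_exp /= hornerZ hornerMn hornerM horner_exp raddf_sum !horner_sum /=.
    have -> : \sum_l (L j l *: x l).[0] = lin j p.
      by apply: eq_bigr => l _; rewrite hornerZ x0.
    rewrite -[in RHS]mulr_natr [in RHS]mulr_suml [in RHS]mulr_suml mulr_sumr.
    by apply: eq_bigr => l _; rewrite derivZ hornerZ; ring.
  have e0 := hx (lift i 0); have e1 := hx (lift i 1).
  rewrite !(sum_lift i) x'i !mulr0 !add0r in e0 e1.
  rewrite (hessC p (lift i 1)) in e1.
  have [x1 x2] : (x (lift i 0))^`().[0] = 0 /\ (x (lift i 1))^`().[0] = 0.
    exact: cramer2 det e0 e1.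
  by move: k; exact: (lift_ind x'i x1 x2).
- rewrite /=; apply: contraNT det; rewrite !negb_or !negbK => /and3P[/eqP h0 /eqP h1 _].
  by rewrite h0 h1 mul0r expr0n subr0.
Qed.
End Nondegenerate.

(** * Sums of five powers in normal coordinates *)

Lemma sum3 (R : nmodType) (F : 'I_3 -> R) : \sum_(l < 3) F l = F 0 + F 1 + F 2.
Proof.
rewrite !big_ord_recl big_ord0 addr0 addrA.
by congr (F _ + F _ + F _); apply: val_inj.
Qed.

Lemma five_sum (R : nmodType) (F : 'I_5 -> R) :
  \sum_j F j = F (@Ordinal 5 0 isT) + F (@Ordinal 5 1 isT) + F (@Ordinal 5 2 isT)
    + F (@Ordinal 5 3 isT) + F (@Ordinal 5 4 isT).
Proof.
rewrite !big_ord_recl big_ord0 addr0 !addrA.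
by congr (F _ + F _ + F _ + F _ + F _); apply: val_inj.
Qed.

(** Along a coordinate line, say z = 0, the third equation says that
    (c1 u^(e+1), c2 v^(e+1)) = k (v, -u) for some k, and then
    c1 c2 y det = k^2 x u v (a1 c2 - a2 c1) (b1 c2 - b2 c1). *)
Lemma curve_det (K : fieldType) (e : nat) (x y a1 b1 c1 a2 b2 c2 : K) :
  let u := a1 * x + b1 * y in let v := a2 * x + b2 * y in
  c1 != 0 -> c2 != 0 -> a1 * b2 - a2 * b1 != 0 -> a1 * c2 - a2 * c1 != 0 ->
  b1 * c2 - b2 * c1 != 0 -> (x != 0) || (y != 0) ->
  x ^+ e.+2 + a1 * u ^+ e.+2 + a2 * v ^+ e.+2 = 0 ->
  y ^+ e.+2 + b1 * u ^+ e.+2 + b2 * v ^+ e.+2 = 0 ->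
  c1 * u ^+ e.+2 + c2 * v ^+ e.+2 = 0 ->
  [/\ x != 0, y != 0 &
    (y ^+ e.+1 + b1 ^+ 2 * u ^+ e.+1 + b2 ^+ 2 * v ^+ e.+1)
    * (c1 ^+ 2 * u ^+ e.+1 + c2 ^+ 2 * v ^+ e.+1)
    - (b1 * c1 * u ^+ e.+1 + b2 * c2 * v ^+ e.+1) ^+ 2 != 0].
Proof.
move=> u v c1N0 c2N0 abN0 acN0 bcN0 xy g0 g1 g2.
have uv0 : u = 0 -> v = 0 -> False.
  move=> u0 v0.
  have xE : (a1 * b2 - a2 * b1) * x = b2 * u - b1 * v by rewrite /u /v; ring.
  have yE : (a1 * b2 - a2 * b1) * y = a1 * v - a2 * u by rewrite /u /v; ring.
  have x0 : x = 0 by apply: (mulfI abN0); rewrite xE u0 v0 !mulr0 subrr.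
  have y0 : y = 0 by apply: (mulfI abN0); rewrite yE u0 v0 !mulr0 subrr.
  by move: xy; rewrite x0 y0 eqxx.
have uN0 : u != 0.
  apply/eqP => u0; apply: uv0 => //; move/eqP: g2.
  by rewrite u0 expr0n mulr0 add0r mulf_eq0 (negbTE c2N0) expf_eq0 => /eqP.
have vN0 : v != 0.
  apply/eqP => v0; apply: uv0 => //; move/eqP: g2.
  by rewrite v0 expr0n mulr0 addr0 mulf_eq0 (negbTE c1N0) expf_eq0 => /eqP.
have xN0 : x != 0.
  apply: contraNneq uN0 => x0; move: g0; rewrite x0 expr0n add0r => g0.
  rewrite -[u == 0]/((0 < e.+2)%N && (u == 0)) -expf_eq0; apply/eqP; apply: (mulfI acN0); rewrite mulr0.
  by transitivity (c2 * (a1 * u ^+ e.+2 + a2 * v ^+ e.+2) - a2 * (c1 * u ^+ e.+2 + c2 * v ^+ e.+2));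
    [ring|rewrite g0 g2 !mulr0 subr0].
have yN0 : y != 0.
  apply: contraNneq uN0 => y0; move: g1; rewrite y0 expr0n add0r => g1.
  rewrite -[u == 0]/((0 < e.+2)%N && (u == 0)) -expf_eq0; apply/eqP; apply: (mulfI bcN0); rewrite mulr0.
  by transitivity (c2 * (b1 * u ^+ e.+2 + b2 * v ^+ e.+2) - b2 * (c1 * u ^+ e.+2 + c2 * v ^+ e.+2));
    [ring|rewrite g1 g2 !mulr0 subr0].
split=> //.
have [w4 w4N0 w4E] : exists2 w4, w4 != 0 & u ^+ e.+1 = w4 by exists (u ^+ e.+1); rewrite ?expf_neq0.
have [w5 w5N0 w5E] : exists2 w5, w5 != 0 & v ^+ e.+1 = w5 by exists (v ^+ e.+1); rewrite ?expf_neq0.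
rewrite !(exprS _ e.+1) w4E w5E in g1 g2; rewrite w4E w5E.
set w2 := y ^+ e.+1 in g1 *.
pose k := c1 * w4 / v.
have kN0 : k != 0 by rewrite !mulf_neq0 ?invr_eq0.
have w4k : w4 = k * v / c1 by rewrite /k divfK // mulrAC mulfV // mul1r.
have w5k : w5 = - (k * u / c2).
  apply: (mulfI c2N0); apply: (mulfI vN0).
  transitivity (- (c1 * u * w4)).
    by apply/eqP; rewrite -addr_eq0 -g2; apply/eqP; ring.
  by rewrite w4k; field; do ?[apply/andP; split].
have w2E : w2 = - (b1 * (u * w4) + b2 * (v * w5)) / y.
  by apply: (mulfI yN0); rewrite [RHS]mulrC divfK //; apply/eqP; rewrite -addr_eq0 addrA g1.
set det := (X in X != 0).
have : det = x * k ^+ 2 * u * v * (a1 * c2 - a2 * c1) * (b1 * c2 - b2 * c1) / (c1 * c2 * y).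
  by rewrite /det w2E w4k w5k /u /v; field; do ?[apply/andP; split].
by move=> ->; rewrite !mulf_neq0 ?invr_eq0 ?expf_neq0 ?mulf_neq0.
Qed.

Section Evaluation.
Context {K : numFieldType}.
Implicit Types P : 'rV[K]_3.

Lemma ev_var i P : ev (var K i) P = P 0 i.
Proof. exact: mevalXU. Qed.

Lemma evZ c (p : mpoly 3 K) P : ev (c *: p) P = c * ev p P.
Proof. exact: mevalZ. Qed.

Lemma ev_exp (p : mpoly 3 K) n P : ev (p ^+ n) P = ev p P ^+ n.
Proof. exact: rmorphXn. Qed.

Lemma evD (p q : mpoly 3 K) P : ev (p + q) P = ev p P + ev q P.
Proof. exact: mevalD. Qed.

Lemma ev_lform a b c P : ev (lform a b c) P = a * P 0 0 + b * P 0 1 + c * P 0 2.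
Proof. by rewrite /lform 2!evD 3!evZ 3!ev_var. Qed.

Lemma ev_five_powers_form d a1 b1 c1 a2 b2 c2 P : ev (five_powers_form d a1 b1 c1 a2 b2 c2) P =
  P 0 0 ^+ d + P 0 1 ^+ d + P 0 2 ^+ d + (a1 * P 0 0 + b1 * P 0 1 + c1 * P 0 2) ^+ d
  + (a2 * P 0 0 + b2 * P 0 1 + c2 * P 0 2) ^+ d.
Proof.
by rewrite /five_powers_form 4!evD 5!ev_exp 2!ev_lform 3!ev_var.
Qed.

Lemma ev_mderiv_var (i j : 'I_3) P : ev (mderiv i (var K j)) P = (i == j)%:R.
Proof.
rewrite /var mderivX mnm1E eq_sym; case: eqP => [->|_]; last by rewrite scale0r /ev meval0.
have -> : mnm_sub (mnm1 j) (mnm1 j) = mnm0 by apply/mnmP => k; rewrite mnmBE mnm0E subnn.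
by rewrite scale1r mpolyX0 /ev meval1.
Qed.

Lemma ev_mderiv_lform (i : 'I_3) a b c P : ev (mderiv i (lform a b c)) P =
  a * (i == 0)%:R + b * (i == 1)%:R + c * (i == 2)%:R.
Proof. by rewrite /lform 2!mderivD 3!mderivZ 2!evD 3!evZ 3!ev_mderiv_var. Qed.

Lemma ev_mderiv_exp i (p : mpoly 3 K) n P :
  ev (mderiv i (p ^+ n.+1)) P = n.+1%:R * (ev p P ^+ n * ev (mderiv i p) P).
Proof.
elim: n => [|n IH]; first by rewrite expr1 expr0 !mul1r.
rewrite exprS mderivM evD /ev !mevalM -!/(ev _ P) IH ev_exp.
by rewrite -[in RHS]nat1r exprS; ring.
Qed.

(** The five bases are variables here: rewriting with concrete linear forms makes
    unification unfold their powers. *)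
Lemma ev_mderiv_sum5 k n (p1 p2 p3 p4 p5 : mpoly 3 K) P x1 x2 x3 x4 x5 d1 d2 d3 d4 d5 :
  ev p1 P = x1 -> ev p2 P = x2 -> ev p3 P = x3 -> ev p4 P = x4 -> ev p5 P = x5 ->
  ev (mderiv k p1) P = d1 -> ev (mderiv k p2) P = d2 -> ev (mderiv k p3) P = d3 ->
  ev (mderiv k p4) P = d4 -> ev (mderiv k p5) P = d5 ->
  ev (mderiv k (p1 ^+ n.+1 + p2 ^+ n.+1 + p3 ^+ n.+1 + p4 ^+ n.+1 + p5 ^+ n.+1)) P =
  n.+1%:R * (d1 * x1 ^+ n + d2 * x2 ^+ n + d3 * x3 ^+ n + d4 * x4 ^+ n + d5 * x5 ^+ n).
Proof.
have D (p q : mpoly 3 K) : ev (mderiv k (p + q)) P = ev (mderiv k p) P + ev (mderiv k q) P.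
  by rewrite mderivD evD.
do 10 move=> <-.
move: (ev_mderiv_exp k p1 n P) (ev_mderiv_exp k p2 n P) (ev_mderiv_exp k p3 n P)
  (ev_mderiv_exp k p4 n P) (ev_mderiv_exp k p5 n P).
move: (p1 ^+ n.+1) (p2 ^+ n.+1) (p3 ^+ n.+1) (p4 ^+ n.+1) (p5 ^+ n.+1) => q1 q2 q3 q4 q5.
move=> e1 e2 e3 e4 e5.
by rewrite 4!D e1 e2 e3 e4 e5; ring.
Qed.

Lemma ev_mderiv_five_powers_form (k : 'I_3) n a1 b1 c1 a2 b2 c2 P :
  ev (mderiv k (five_powers_form n.+1 a1 b1 c1 a2 b2 c2)) P =
  n.+1%:R * ((k == 0)%:R * P 0 0 ^+ n + (k == 1)%:R * P 0 1 ^+ n + (k == 2)%:R * P 0 2 ^+ n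
  + (a1 * (k == 0)%:R + b1 * (k == 1)%:R + c1 * (k == 2)%:R)
      * (a1 * P 0 0 + b1 * P 0 1 + c1 * P 0 2) ^+ n
  + (a2 * (k == 0)%:R + b2 * (k == 1)%:R + c2 * (k == 2)%:R)
      * (a2 * P 0 0 + b2 * P 0 1 + c2 * P 0 2) ^+ n).
Proof.
apply: ev_mderiv_sum5;
  [exact: ev_var|exact: ev_var|exact: ev_var|exact: ev_lform|exact: ev_lform
  |exact: ev_mderiv_var|exact: ev_mderiv_var|exact: ev_mderiv_var
  |exact: ev_mderiv_lform|exact: ev_mderiv_lform].
Qed.

End Evaluation.

(** Row j holds the coefficients of the j-th of the forms x, y, z, u, v. *)
Definition five_lin (K : numClosedFieldType) (a1 b1 c1 a2 b2 c2 : K) (j : 'I_5) (k : 'I_3) : K :=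
  nth 0 (nth [::] [:: [:: 1; 0; 0]; [:: 0; 1; 0]; [:: 0; 0; 1]; [:: a1; b1; c1];
    [:: a2; b2; c2]] j) k.

Section FivePowersSingularities.
Context {K : numClosedFieldType}.
Variables a1 b1 c1 a2 b2 c2 : K.
Variable e : nat.
Local Notation f := (five_powers_form e.+3 a1 b1 c1 a2 b2 c2).
Local Notation L := (five_lin a1 b1 c1 a2 b2 c2).
Local Notation u p := (a1 * p 0 0 + b1 * p 0 1 + c1 * p 0 2).
Local Notation v p := (a2 * p 0 0 + b2 * p 0 1 + c2 * p 0 2).

Lemma five_linE (F : K -> K -> K -> K -> K) (p : 'rV[K]_3) :
  \sum_j F (L j 0) (L j 1) (L j 2) (lin L j p) =
  F 1 0 0 (p 0 0) + F 0 1 0 (p 0 1) + F 0 0 1 (p 0 2) + F a1 b1 c1 (u p) + F a2 b2 c2 (v p).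
Proof.
rewrite five_sum /lin !sum3 /five_lin /=.
by rewrite !mul1r !mul0r !(add0r, addr0).
Qed.

Lemma ev_five_powers (P : 'rV[K]_3) : ev f P = \sum_j lin L j P ^+ e.+3.
Proof.
by rewrite (five_linE (fun _ _ _ l => l ^+ e.+3)) ev_five_powers_form.
Qed.

Definition five_grad (p : 'rV[K]_3) (k : 'I_3) : K := \sum_j L j k * lin L j p ^+ e.+2.

Lemma ev_mderiv_five_powers (k : 'I_3) (P : 'rV[K]_3) :
  ev (mderiv k f) P = e.+3%:R * five_grad P k.
Proof.
rewrite ev_mderiv_five_powers_form; congr (_ * _).
rewrite /five_grad five_sum /lin !sum3 /five_lin /=.
rewrite !mul1r !mul0r !(add0r, addr0).
by case: k => -[|[|[|//]]] hk; rewrite -!val_eqE /= !mulr0 !mulr1 !(add0r, addr0).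
Qed.

Lemma five_gradZ c p k : five_grad (c *: p) k = c ^+ e.+2 * five_grad p k.
Proof.
rewrite /five_grad mulr_sumr; apply: eq_bigr => j _.
have -> : lin L j (c *: p) = c * lin L j p.
  by rewrite /lin mulr_sumr; apply: eq_bigr => l _; rewrite mxE mulrCA.
by rewrite exprMn mulrCA.
Qed.

Lemma type_A_scale m (g : mpoly 3 K) c p : c != 0 -> type_A m g (c *: p) -> type_A m g p.
Proof.
move=> c0 [i pi iso]; exists i; first by move: pi; rewrite mxE mulf_eq0 negb_or => /andP[].
have <- // : chart_coord i (c *: p) = chart_coord i p.
apply/rowP => j; rewrite !mxE; rewrite !mxE in pi.
by rewrite invfM mulrACA mulfV // mul1r.
Qed.

Lemma five_gradE (p : 'rV[K]_3) :
  [/\ five_grad p 0 = p 0 0 ^+ e.+2 + a1 * u p ^+ e.+2 + a2 * v p ^+ e.+2,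
      five_grad p 1 = p 0 1 ^+ e.+2 + b1 * u p ^+ e.+2 + b2 * v p ^+ e.+2
    & five_grad p 2 = p 0 2 ^+ e.+2 + c1 * u p ^+ e.+2 + c2 * v p ^+ e.+2].
Proof.
split; [rewrite /five_grad (five_linE (fun x _ _ l => x * l ^+ e.+2))
       |rewrite /five_grad (five_linE (fun _ x _ l => x * l ^+ e.+2))
       |rewrite /five_grad (five_linE (fun _ _ x l => x * l ^+ e.+2))];
  by rewrite !mul1r !mul0r !(add0r, addr0).
Qed.

Lemma five_hess_diagE (p : 'rV[K]_3) :
  [/\ hess e L p 0 0 = p 0 0 ^+ e.+1 + a1 ^+ 2 * u p ^+ e.+1 + a2 ^+ 2 * v p ^+ e.+1,
      hess e L p 1 1 = p 0 1 ^+ e.+1 + b1 ^+ 2 * u p ^+ e.+1 + b2 ^+ 2 * v p ^+ e.+1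
    & hess e L p 2 2 = p 0 2 ^+ e.+1 + c1 ^+ 2 * u p ^+ e.+1 + c2 ^+ 2 * v p ^+ e.+1].
Proof.
split; [rewrite /hess (five_linE (fun x _ _ l => x * x * l ^+ e.+1))
       |rewrite /hess (five_linE (fun _ x _ l => x * x * l ^+ e.+1))
       |rewrite /hess (five_linE (fun _ _ x l => x * x * l ^+ e.+1))];
  by rewrite !mul1r !mul0r !(add0r, addr0) !expr2.
Qed.

Lemma five_hess_offdiagE (p : 'rV[K]_3) :
  [/\ hess e L p 0 1 = a1 * b1 * u p ^+ e.+1 + a2 * b2 * v p ^+ e.+1,
      hess e L p 0 2 = a1 * c1 * u p ^+ e.+1 + a2 * c2 * v p ^+ e.+1
    & hess e L p 1 2 = b1 * c1 * u p ^+ e.+1 + b2 * c2 * v p ^+ e.+1].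
Proof.
split; [rewrite /hess (five_linE (fun x y _ l => x * y * l ^+ e.+1))
       |rewrite /hess (five_linE (fun x _ y l => x * y * l ^+ e.+1))
       |rewrite /hess (five_linE (fun _ x y l => x * y * l ^+ e.+1))];
  by rewrite !(mulr0, mul0r) !(add0r, addr0).
Qed.

Hypothesis gen : general_coefficients a1 b1 c1 a2 b2 c2.

(** If the 2 x 2 block of the Hessian vanished, Euler's relation would kill the
    whole Hessian matrix; its off-diagonal entries give u = v = 0, and then the
    third partial derivative is z^(d-1) = 1. *)
Lemma five_powers_type_A (p : 'rV[K]_3) : p 0 2 = 1 -> (forall k, five_grad p k = 0) ->
  exists2 m, (1 <= m)%N & type_A m f p.
Proof.
have [/and5P[a1N0 b1N0 c1N0 a2N0 /andP[b2N0 c2N0]] [abN0 acN0 bcN0]] := gen.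
move=> p2 grad.
have [n flat] := no_flat_curve b1N0 a2N0 b2N0 c2N0 acN0 e.
have l0 : lift (2 : 'I_3) (0 : 'I_2) = 0 by exact: val_inj.
have l1 : lift (2 : 'I_3) (1 : 'I_2) = 1 by exact: val_inj.
have [||m [m1 _ tA]] := power_sum_singularity (n := n) ev_five_powers p2 grad; last by exists m.
- rewrite /= l0 l1 -!negb_and; apply/negP => /and3P[/eqP + /eqP + _].
  have [-> _ _] := five_hess_diagE p; have [-> _ _] := five_hess_offdiagE p.
  have [] := five_gradE p; rewrite !grad p2 expr1n !mulr1 !(exprS _ e.+1).
  move w1E : (_ 0 0 ^+ e.+1) => w1; move w4E : ((a1 * _ + _ + _) ^+ e.+1) => w4.
  move w5E : ((a2 * _ + _ + _) ^+ e.+1) => w5; move=> g0 _ g2 h00 h01.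
  have h02 : a1 * c1 * w4 + a2 * c2 * w5 = 0.
    transitivity ((p 0 0 * w1 + a1 * ((a1 * p 0 0 + b1 * p 0 1 + c1) * w4)
       + a2 * ((a2 * p 0 0 + b2 * p 0 1 + c2) * w5))
       - p 0 0 * (w1 + a1 ^+ 2 * w4 + a2 ^+ 2 * w5) - p 0 1 * (a1 * b1 * w4 + a2 * b2 * w5)).
      by ring.
    by rewrite -g0 h00 h01 !mulr0 !subr0.
  have w4_0 : w4 = 0.
    apply: (mulfI (mulf_neq0 a1N0 bcN0)); rewrite mulr0.
    transitivity (c2 * (a1 * b1 * w4 + a2 * b2 * w5) - b2 * (a1 * c1 * w4 + a2 * c2 * w5)).
      by ring.
    by rewrite h01 h02 !mulr0 subr0.
  have w5_0 : w5 = 0.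
    apply: (mulfI (mulf_neq0 a2N0 b2N0)); rewrite mulr0.
    by move: h01; rewrite w4_0 mulr0 add0r.
  by move/esym/eqP: g2; rewrite w4_0 w5_0 !mulr0 !addr0 oner_eq0.
- move=> x x2 x0 xF k.
  have [] := flat (x 0) (x 1).
  + have := xF 0; rewrite five_sum !sum3 /five_lin /= x2.
    by rewrite !scale1r !scale0r !alg_polyC !(add0r, addr0).
  + have := xF 2; rewrite five_sum !sum3 /five_lin /= x2.
    by rewrite !scale1r !scale0r !alg_polyC !(add0r, addr0) expr1n.
  move=> x0' x1'; move: k; apply: (@lift_ind 2); rewrite ?l0 ?l1 //.
  by rewrite x2 derivC horner0.
Qed.

(** At a point of a coordinate line, [curve_det] provides a nonzero 2 x 2 minor of
    the Hessian matrix and a nonzero coordinate. The chart of that coordinate is the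
    one in which the minor is the Hessian determinant of the affine equation. *)
Lemma five_powers_type_A1 (p : 'rV[K]_3) : p != 0 -> (forall k, five_grad p k = 0) ->
  p 0 0 * p 0 1 * p 0 2 = 0 -> type_A 1 f p.
Proof.
have [/and5P[a1N0 b1N0 c1N0 a2N0 /andP[b2N0 c2N0]] [abN0 acN0 bcN0]] := gen.
(* The three coordinate lines are treated by the same computation, with the
   variables permuted. *)
have baN0 : b1 * a2 - b2 * a1 != 0 by rewrite -opprB oppr_eq0 mulrC [b1 * _]mulrC.
have caN0 : c1 * a2 - c2 * a1 != 0 by rewrite -opprB oppr_eq0 mulrC [c1 * _]mulrC.
have cbN0 : c1 * b2 - c2 * b1 != 0 by rewrite -opprB oppr_eq0 mulrC [c1 * _]mulrC.
have on_x (q : 'rV[K]_3) : q 0 0 = 0 -> (q 0 1 != 0) || (q 0 2 != 0) ->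
    (forall k, five_grad q k = 0) ->
    q 0 1 != 0 /\ hess e L q 0 0 * hess e L q 2 2 - hess e L q 0 2 ^+ 2 != 0.
  move=> q0 nz grad; have [g0 g1 g2] := five_gradE q.
  have [h00 _ h22] := five_hess_diagE q; have [_ h02 _] := five_hess_offdiagE q.
  rewrite q0 !mulr0 !add0r !grad !expr0n !add0r in g0 g1 g2 h00 h22 h02.
  have [q1 _ det] := curve_det a1N0 a2N0 bcN0 baN0 caN0 nz (esym g1) (esym g2) (esym g0).
  by rewrite h00 h22 h02 mulrC [a1 * c1]mulrC [a2 * c2]mulrC; split.
have on_y (q : 'rV[K]_3) : q 0 1 = 0 -> (q 0 0 != 0) || (q 0 2 != 0) ->
    (forall k, five_grad q k = 0) ->
    q 0 0 != 0 /\ hess e L q 1 1 * hess e L q 2 2 - hess e L q 1 2 ^+ 2 != 0.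
  move=> q0 nz grad; have [g0 g1 g2] := five_gradE q.
  have [_ h11 h22] := five_hess_diagE q; have [_ _ h12] := five_hess_offdiagE q.
  rewrite q0 !mulr0 !addr0 !grad !expr0n !add0r in g0 g1 g2 h11 h22 h12.
  have [q1 _ det] := curve_det b1N0 b2N0 acN0 abN0 cbN0 nz (esym g0) (esym g2) (esym g1).
  by rewrite h11 h22 h12 mulrC [b1 * c1]mulrC [b2 * c2]mulrC; split.
have on_z (q : 'rV[K]_3) : q 0 2 = 0 -> (q 0 0 != 0) || (q 0 1 != 0) ->
    (forall k, five_grad q k = 0) ->
    q 0 0 != 0 /\ hess e L q 1 1 * hess e L q 2 2 - hess e L q 1 2 ^+ 2 != 0.
  move=> q0 nz grad; have [g0 g1 g2] := five_gradE q.
  have [_ h11 h22] := five_hess_diagE q; have [_ _ h12] := five_hess_offdiagE q.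
  rewrite q0 !mulr0 !addr0 !grad !expr0n !add0r in g0 g1 g2 h11 h22 h12.
  have [q1 _ det] := curve_det c1N0 c2N0 abN0 acN0 bcN0 nz (esym g0) (esym g1) (esym g2).
  by rewrite h11 h22 h12; split.
have rescale (i : 'I_3) (P : 'rV[K]_3) : P 0 i != 0 -> (forall k, five_grad P k = 0) ->
    (let q := (P 0 i)^-1 *: P in q 0 i != 0 -> (forall k, five_grad q k = 0) ->
     let h k l := hess e L q (lift i k) (lift i l) in
     h 0 0 * h 1 1 - h 0 1 ^+ 2 != 0) -> type_A 1 f P.
  move=> pi grad det; apply: (@type_A_scale _ _ (P 0 i)^-1); first by rewrite invr_eq0.
  have grad' k : five_grad ((P 0 i)^-1 *: P) k = 0 by rewrite five_gradZ grad mulr0.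
  have q1 : ((P 0 i)^-1 *: P) 0 i = 1 by rewrite mxE mulVf.
  by apply: (nondegenerate_type_A1 ev_five_powers q1 grad'); apply: det => //; rewrite q1 oner_neq0.
have l00 : lift (0 : 'I_3) (0 : 'I_2) = 1 by exact: val_inj.
have l01 : lift (0 : 'I_3) (1 : 'I_2) = 2 by exact: val_inj.
have l10 : lift (1 : 'I_3) (0 : 'I_2) = 0 by exact: val_inj.
have l11 : lift (1 : 'I_3) (1 : 'I_2) = 2 by exact: val_inj.
have pN0 : p 0 0 = 0 -> p 0 1 = 0 -> p 0 2 = 0 -> p = 0.
  move=> p0 p1 p2; apply/rowP => k; rewrite mxE.
  by case: k => -[|[|[|//]]] k3; [rewrite -p0|rewrite -p1|rewrite -p2]; congr (p _ _); exact: val_inj.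
move=> p0 grad /eqP; rewrite !mulf_eq0 -orbA => /or3P[] /eqP z.
- have nz : (p 0 1 != 0) || (p 0 2 != 0).
    by apply: contraNT p0; rewrite negb_or !negbK => /andP[/eqP p1 /eqP p2]; rewrite (pN0 z p1 p2).
  have [p1 _] := on_x p z nz grad.
  apply: (rescale 1) => // q q1 grad'; rewrite /= l10 l11.
  by have [] // := on_x q; rewrite ?q1 // /q mxE z mulr0.
- have nz : (p 0 0 != 0) || (p 0 2 != 0).
    by apply: contraNT p0; rewrite negb_or !negbK => /andP[/eqP p1 /eqP p2]; rewrite (pN0 p1 z p2).
  have [p1 _] := on_y p z nz grad.
  apply: (rescale 0) => // q q1 grad'; rewrite /= l00 l01.
  by have [] // := on_y q; rewrite ?q1 // /q mxE z mulr0.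
- have nz : (p 0 0 != 0) || (p 0 1 != 0).
    by apply: contraNT p0; rewrite negb_or !negbK => /andP[/eqP p1 /eqP p2]; rewrite (pN0 p1 p2 z).
  have [p1 _] := on_z p z nz grad.
  apply: (rescale 0) => // q q1 grad'; rewrite /= l00 l01.
  by have [] // := on_z q; rewrite ?q1 // /q mxE z mulr0.
Qed.

Lemma five_powers_singularities p : singular_point f p ->
  (exists2 m : nat, (1 <= m)%N & type_A m f p) /\
  (p 0 0 * p 0 1 * p 0 2 = 0 -> type_A 1 f p).
Proof.
move=> [p0 _ dp].
have grad k : five_grad p k = 0.
  by apply/eqP; have /eqP := dp k; rewrite ev_mderiv_five_powers mulf_eq0 pnatr_eq0.
split; last exact: five_powers_type_A1.
have [p2|p2] := eqVneq (p 0 2) 0.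
  by exists 1%N => //; apply: five_powers_type_A1 => //; rewrite p2 mulr0.
have [||m m1 tA] := @five_powers_type_A ((p 0 2)^-1 *: p).
- by rewrite mxE mulVf.
- by move=> k; rewrite five_gradZ grad mulr0.
by exists m => //; apply: type_A_scale tA; rewrite invr_eq0.
Qed.

End FivePowersSingularities.

(** * Linear forms and linear changes of coordinates *)

Section LinearForms.
Context {K : numFieldType}.
Implicit Types (a p : 'rV[K]_3) (M : 'M[K]_3) (P : 'rV[K]_3).

Definition row_form a : mpoly 3 K := lform (a 0 0) (a 0 1) (a 0 2).

Lemma ev_row_form a P : ev (row_form a) P = \sum_k a 0 k * P 0 k.
Proof. by rewrite ev_lform sum3. Qed.

Lemma row_formE a : row_form a = \sum_k a 0 k *: var K k.
Proof. by rewrite sum3. Qed.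

Lemma homog1_row_form (f : mpoly 3 K) : f \is ishomog1 1 mdeg -> exists a, f = row_form a.
Proof.
move=> hf; pose c k := mcoeff (mnm1 k) f; exists (\row_k c k).
have -> : row_form (\row_k c k) = \sum_k c k *: var K k.
  by rewrite row_formE; apply: eq_bigr => k _; rewrite mxE.
apply/mpolyP => m; rewrite raddf_sum /=.
under eq_bigr do rewrite mcoeffZ mcoeffX.
have [/eqP/mdeg1P[i /eqP ->]|m1] := eqVneq (mdeg m) 1%N.
  rewrite (bigD1 i) //= eqxx mulr1 big1 ?addr0 // => k ki.
  case: eqP => [/mnmP/(_ i)|_]; last by rewrite mulr0.
  by rewrite !mnm1E eqxx (negbTE ki).
rewrite (dhomog_nemf_coeff hf m1) big1 // => k _.
by case: eqP => [km|_]; [move: m1; rewrite -km mdeg1|rewrite mulr0].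
Qed.

Lemma lin_subst_var M i : lin_subst M (var K i) = \sum_(j < 3) M i j *: var K j.
Proof. by rewrite /lin_subst comp_mpolyXU -tnth_nth tnth_mktuple. Qed.

Lemma lin_substZ M c (f : mpoly 3 K) : lin_subst M (c *: f) = c *: lin_subst M f.
Proof. exact: comp_mpolyZ. Qed.

Lemma lin_subst_row_form M a : lin_subst M (row_form a) = row_form (a *m M).
Proof.
rewrite !row_formE {1}/lin_subst raddf_sum /=.
transitivity (\sum_k \sum_j (a 0 k * M k j) *: var K j).
  apply: eq_bigr => k _; rewrite -/(lin_subst M _) lin_substZ lin_subst_var scaler_sumr.
  by apply: eq_bigr => j _; rewrite scalerA.
rewrite exchange_big /=; apply: eq_bigr => j _.
by rewrite mxE scaler_suml.
Qed.

Lemma lin_subst_power_sum M r d (a : 'I_r -> 'rV[K]_3) :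
  lin_subst M (\sum_j row_form (a j) ^+ d) = \sum_j row_form (a j *m M) ^+ d.
Proof.
rewrite /lin_subst rmorph_sum /=; apply: eq_bigr => j _.
by rewrite rmorphXn /= -/(lin_subst M _) lin_subst_row_form.
Qed.
End LinearForms.

(** * Degrees at most two *)

Section LowDegree.
Context {K : numFieldType}.

(** Gaussian elimination writes a nonzero row as a multiple of the first row of an
    invertible matrix. *)
Lemma exists_unitmx_col (p : 'rV[K]_3) : p != 0 ->
  exists2 N : 'M[K]_3, N \in unitmx & exists c, forall k, N k 2 = c * p 0 k.
Proof.
move=> p0; have := mulmx_ebase p; rewrite rank_rV p0 => def_p.
pose a := col_ebase p 0 0.
have a0 : a != 0.
  have := col_ebase_unit p; rewrite unitmxE det_mx11 unitfE; exact.
have pE : p = a *: row 0 (row_ebase p).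
  rewrite -[LHS]def_p; apply/rowP => k; rewrite !mxE.
  rewrite (bigD1 0) //= !mxE big_ord1 !mxE /= mulr1 big1 ?addr0 // => i i0.
  have i0' : ((0 : 'I_1) == i :> nat) = false by rewrite eq_sym; exact: negbTE.
  by rewrite !mxE big_ord1 !mxE i0' mulr0 mul0r.
exists (xrow 0 2 (row_ebase p))^T.
  by rewrite unitmx_tr xrowE unitmx_mul unitmx_perm row_ebase_unit.
have pk k : p 0 k = a * row_ebase p 0 k by rewrite {1}pE !mxE.
by exists a^-1 => k; rewrite pk !mxE tpermR mulKf.
Qed.

Lemma ev_sum r (F : 'I_r -> mpoly 3 K) P : ev (\sum_j F j) P = \sum_j ev (F j) P.
Proof. exact: raddf_sum. Qed.

Lemma ev_mderiv_row_form k (a P : 'rV[K]_3) : ev (mderiv k (row_form a)) P = a 0 k.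
Proof.
rewrite ev_mderiv_lform.
by case: k => -[|[|[|//]]] hk; rewrite -!val_eqE /= !mulr0 !mulr1 !(add0r, addr0);
  congr (a _ _); apply: val_inj.
Qed.

Lemma sqr_split (x y z : mpoly 3 K) (a b c : K) :
  (a *: x + b *: y + c *: z) ^+ 2 =
  (a *: x + b *: y) ^+ 2 + (a * c) *: (x * z *+ 2) + (b * c) *: (y * z *+ 2) + (c * c) *: (z * z).
Proof.
have sqrD2 (R : comNzRingType) (X Y Z : R) :
  (X + Y + Z) ^+ 2 = (X + Y) ^+ 2 + X * Z *+ 2 + Y * Z *+ 2 + Z * Z by ring.
have scM (s t : K) (X Y : mpoly 3 K) : (s *: X) * (t *: Y) = (s * t) *: (X * Y).
  by rewrite -scalerAl -scalerAr scalerA.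
by rewrite sqrD2 !scM !scalerMnr.
Qed.

(** In coordinates where the singular point is the last coordinate point, the
    gradient condition says that the products with the last variable cancel in the
    sum of squares. *)
Lemma quadric_nonsingular r (f : mpoly 3 K) (a : 'I_r -> 'rV[K]_3) (M : 'M[K]_3) p :
  essentially_ternary f -> f = \sum_j row_form (a j) ^+ 2 -> M \in unitmx ->
  ~ singular_point (lin_subst M f) p.
Proof.
move=> ess def_f Mu [p0 _ dp].
have [N Nu [c Nc]] := exists_unitmx_col p0.
apply: (ess (M *m N)); first by rewrite unitmx_mul Mu.
rewrite def_f lin_subst_power_sum in dp *.
pose b j := a j *m (M *m N).
have grad k : \sum_j (a j *m M) 0 k * ev (row_form (a j *m M)) p = 0.
  have := dp k; rewrite raddf_sum ev_sum /= => h.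
  suff : 2%:R * \sum_j (a j *m M) 0 k * ev (row_form (a j *m M)) p = 0.
    by move/eqP; rewrite mulf_eq0 pnatr_eq0 => /eqP.
  rewrite -[RHS]h mulr_sumr; apply: eq_bigr => j _.
  by rewrite ev_mderiv_exp expr1 ev_mderiv_row_form; ring.
have b2 j : b j 0 2 = c * ev (row_form (a j *m M)) p.
  rewrite /b mulmxA mxE ev_row_form mulr_sumr; apply: eq_bigr => k _.
  by rewrite Nc mulrCA.
have ortho k : \sum_j b j 0 k * b j 0 2 = 0.
  transitivity (c * \sum_l N l k * \sum_j (a j *m M) 0 l * ev (row_form (a j *m M)) p).
    under [X in c * X]eq_bigr do rewrite mulr_sumr.
    rewrite exchange_big /= mulr_sumr; apply: eq_bigr => j _.
    rewrite b2 /b mulmxA [(_ *m N) 0 k]mxE mulr_suml [RHS]mulr_sumr; apply: eq_bigr => l _.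
    by ring.
  by rewrite big1 ?mulr0 // => l _; rewrite grad mulr0.
exists (\sum_j ((b j 0 0) *: mpolyX K (mnm1 (0 : 'I_2)) + (b j 0 1) *: mpolyX K (mnm1 (1 : 'I_2))) ^+ 2).
rewrite lin_subst_power_sum raddf_sum /=.
transitivity (\sum_j row_form (b j) ^+ 2); first by [].
transitivity (\sum_j ((b j 0 0) *: var K 0 + (b j 0 1) *: var K 1) ^+ 2).
  rewrite /row_form /lform.
  under eq_bigr do rewrite sqr_split.
  by rewrite !big_split /= -!scaler_suml !ortho !scale0r !addr0.
apply: eq_bigr => j _; rewrite rmorphXn rmorphD /= !mwidenZ !mwidenX !mnmwiden1.
by congr ((_ *: mpolyX _ (mnm1 _) + _ *: mpolyX _ (mnm1 _)) ^+ 2); apply: val_inj.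
Qed.

Lemma degree0_not_essentially_ternary r (l : 'I_r -> mpoly 3 K) :
  ~ essentially_ternary (\sum_j l j ^+ 0).
Proof.
move=> /(_ 1%:M (unitmx1 _ _)); apply.
exists (r%:R); rewrite (eq_bigr (fun=> 1)) ?sumr_const ?card_ord; last by move=> j _; rewrite expr0.
by rewrite /lin_subst !rmorph_nat.
Qed.

Lemma degree1_waring_rank (f : mpoly 3 K) r : f \is ishomog1 1 mdeg ->
  waring_rank 1 f r -> (r <= 1)%N.
Proof.
move=> hf [_ /(_ 1%N (fun=> f))]; apply; split => //.
by rewrite big_ord1 expr1.
Qed.
End LowDegree.

(** * Five lines without triple points *)

Section FiveLines.
Context {K : numFieldType}.
Variable l : 'I_5 -> mpoly 3 K.
Implicit Type P Q : 'rV[K]_3.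

Definition no_triple_point := forall i j k : 'I_5, i != j -> i != k -> j != k ->
  forall P, ev (l i) P = 0 -> ev (l j) P = 0 -> ev (l k) P = 0 -> P = 0.

Lemma only_double_no_triple : only_double_points l -> no_triple_point.
Proof.
move=> dbl i j k ij ik jk P li lj lk; apply/eqP/negPn/negP => P0.
have : (3 <= nb_lines_through l P)%N.
  apply: (@leq_trans #|[set i; j; k]%SET|).
    by rewrite finset.setUC !cardsU1 cards1 !inE negb_or eq_sym ik eq_sym jk ij.
  apply/subset_leq_card/fintype.subsetP => h; rewrite !inE -orbA.
  by case/or3P => /eqP ->; rewrite ?li ?lj ?lk.
by move=> n3; have n2 : nb_lines_through l P = 2%N := dbl P P0 (ltnW n3); rewrite n2 in n3.
Qed.
End FiveLines.

Section GeneralPosition.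
Context {K : numFieldType}.
Variable a : 'I_5 -> 'rV[K]_3.
Local Notation l := (fun j => row_form (a j)).
Hypothesis gen : no_triple_point l.

(** A 3 x 3 matrix with two equal columns has a nonzero kernel. *)
Lemma common_zero i j :
  exists2 P : 'rV[K]_3, P != 0 & ev (row_form (a i)) P = 0 /\ ev (row_form (a j)) P = 0.
Proof.
pose A := \matrix_(k, c) (if c == 0 :> 'I_3 then a i 0 k else a j 0 k).
have : \det A == 0.
  rewrite -det_tr; apply/eqP/(@determinant_alternate _ _ _ 1 2) => // k.
  by rewrite !mxE.
case/det0P => P P0 PA; exists P => //.
split; rewrite ev_row_form.
  transitivity ((P *m A) 0 0); last by rewrite PA mxE.
  by rewrite mxE; apply: eq_bigr => k _; rewrite mxE mulrC.
transitivity ((P *m A) 0 1); last by rewrite PA mxE.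
by rewrite mxE; apply: eq_bigr => k _; rewrite mxE mulrC.
Qed.

Lemma ev_row_formB (x P Q : 'rV[K]_3) c : ev (row_form x) (P - c *: Q) =
  ev (row_form x) P - c * ev (row_form x) Q.
Proof.
rewrite !ev_row_form mulr_sumr -sumrB; apply: eq_bigr => k _.
by rewrite !mxE mulrBr mulrCA.
Qed.

(** A third form is nonzero at both points, and the combination of the two points
    that it kills is killed by three forms. *)
Lemma common_zero_uniq i j (P Q : 'rV[K]_3) : i != j -> P != 0 -> Q != 0 ->
  ev (row_form (a i)) P = 0 -> ev (row_form (a j)) P = 0 ->
  ev (row_form (a i)) Q = 0 -> ev (row_form (a j)) Q = 0 -> <[P]>%VS = <[Q]>%VS.
Proof.
move=> ij.
have [k [ki kj]] : exists k : 'I_5, k != i /\ k != j.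
  have : (0 < #|~: [set i; j]%SET|)%N.
    by rewrite cardsCs finset.setCK card_ord subn_gt0 cards2; case: (_ != _).
  by case/card_gt0P => k; rewrite !inE negb_or => /andP[ki kj]; exists k.
have sub X Y : Y != 0 -> ev (row_form (a i)) X = 0 -> ev (row_form (a j)) X = 0 ->
  ev (row_form (a i)) Y = 0 -> ev (row_form (a j)) Y = 0 -> (<[X]> <= <[Y]>)%VS.
  move=> Y0 iX jX iY jY; rewrite -memvE; apply/vlineP.
  have kY : ev (row_form (a k)) Y != 0.
    by apply: contra_neq Y0 => kY; apply: (gen ij _ _ iY jY kY); rewrite eq_sym.
  exists (ev (row_form (a k)) X / ev (row_form (a k)) Y).
  have [ik jk] : i != k /\ j != k by rewrite ![_ == k]eq_sym.
  apply/eqP; rewrite -subr_eq0; apply/eqP; apply: (gen ij ik jk).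
  - by rewrite ev_row_formB iX iY mulr0 subr0.
  - by rewrite ev_row_formB jX jY mulr0 subr0.
  - by rewrite ev_row_formB divfK // subrr.
by move=> P0 Q0 iP jP iQ jQ; apply/eqP; rewrite eqEsubv !sub.
Qed.

Definition pairs : {set 'I_5 * 'I_5} := [set ij : 'I_5 * 'I_5 | (ij.1 < ij.2)%N]%SET.

Lemma card_pairs : #|pairs| = 10%N.
Proof.
rewrite -sum1_card (eq_bigl (fun ij : 'I_5 * 'I_5 => (ij.1 < ij.2)%N)); last by move=> ij; rewrite inE.
rewrite -(pair_big_dep xpredT (fun i j : 'I_5 => (i < j)%N) (fun _ _ => 1%N)) /=.
under eq_bigr do rewrite big_mkcond /=.
by rewrite !big_ord_recl !big_ord0.
Qed.

(** Each pair of forms has a common zero, unique up to scaling, and a double point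
    determines the pair of forms that vanish there. *)
Lemma card_double_points : only_double_points l -> (double_points l #= `I_10)%card.
Proof.
move=> dbl.
pose pt ij := sval (cid2 (common_zero ij.1 ij.2)).
have pt0 ij : pt ij != 0 by rewrite /pt; case: cid2.
have pt1 ij : ev (row_form (a ij.1)) (pt ij) = 0 by rewrite /pt; case: cid2 => ? ? [].
have pt2 ij : ev (row_form (a ij.2)) (pt ij) = 0 by rewrite /pt; case: cid2 => ? ? [].
have -> : double_points l = [set <[pt ij]>%VS | ij in [set` pairs]].
  apply/seteqP; split => [L [P [P0 nb2] <-]|L [ij]].
    have : #|[set j | ev (row_form (a j)) P == 0]%SET| == 2%N by rewrite cardsE; exact/eqP.
    case/cards2P => i [j] [ij Pij].
    have zi : ev (row_form (a i)) P = 0.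
      by have := set21 i j; rewrite -Pij inE => /eqP.
    have zj : ev (row_form (a j)) P = 0.
      by have := set22 i j; rewrite -Pij inE => /eqP.
    wlog lt_ij : i j ij zi zj {Pij} / (i < j)%N.
      move=> H; case: (ltngtP i j) => [|ji|/val_inj eij]; first exact: H.
        by apply: H ji => //; rewrite eq_sym.
      by rewrite eij eqxx in ij.
    exists (i, j); first by rewrite /= inE.
    by apply: (common_zero_uniq ij) => //; [exact: (pt1 (i, j))|exact: (pt2 (i, j))].
  rewrite /= inE => lt_ij <-; exists (pt ij) => //; split=> //; apply: dbl => //.
  apply: (@leq_trans #|[set ij.1; ij.2]%SET|); first by rewrite cards2 neq_ltn lt_ij.
  apply/subset_leq_card/fintype.subsetP => h; rewrite !inE.
  by case/orP => /eqP ->; rewrite ?pt1 ?pt2.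
have -> : ([set <[pt ij]>%VS | ij in [set` pairs]] #= `I_10)%card =
    ([set` pairs] #= `I_10)%card.
  apply: card_eql; apply: inj_card_eq => -[i j] [k m].
  rewrite !inE /= ![_ \in pairs]inE /= => lt_ij lt_km eqpt.
  have [c def_pt] : exists c, pt (k, m) = c *: pt (i, j).
    by apply/vlineP; rewrite eqpt memv_line.
  have evZ x : ev (row_form x) (pt (k, m)) = c * ev (row_form x) (pt (i, j)).
    by rewrite def_pt !ev_row_form mulr_sumr; apply: eq_bigr => h _; rewrite mxE mulrCA.
  have ij : i != j by rewrite neq_ltn lt_ij.
  have zero h : ev (row_form (a h)) (pt (k, m)) = 0 -> (h == i) || (h == j).
    move=> hz; apply: contraT; rewrite negb_or => /andP[hi hj].
    have /eqP [] := pt0 (k, m); apply: (gen ij _ _ _ _ hz); rewrite 1?eq_sym // evZ.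
      by rewrite (pt1 (i, j)) mulr0.
    by rewrite (pt2 (i, j)) mulr0.
  have := zero _ (pt1 (k, m)); have := zero _ (pt2 (k, m)) => /=.
  case/orP => /eqP em /orP[] /eqP ek; move: lt_km; rewrite em ek ?ltnn //.
  by move=> ji; have := ltn_trans lt_ij ji; rewrite ltnn.
have -> : `I_10 = [set index ij (enum pairs) | ij in [set` pairs]].
  have szE : size (enum pairs) = 10%N by rewrite -cardE card_pairs.
  apply/seteqP; split=> [n n10|n [ij /= ijP <-]]; last first.
    by rewrite -szE index_mem mem_enum.
  have n10' : (n < size (enum pairs))%N by rewrite szE.
  exists (nth (ord0, ord0) (enum pairs) n); last by rewrite index_uniq ?enum_uniq.
  by rewrite /= -mem_enum mem_nth.
rewrite card_eq_sym; apply: inj_card_eq => x y xP yP eqi.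
have xe : x \in enum pairs by rewrite mem_enum; rewrite inE in xP.
have ye : y \in enum pairs by rewrite mem_enum; rewrite inE in yP.
by rewrite -(nth_index x xe) eqi nth_index.
Qed.
End GeneralPosition.

Section NormalCoordinates.
Context {K : numFieldType}.

Lemma ev_row_form_mul (x P : 'rV[K]_3) (M : 'M[K]_3) :
  ev (row_form (x *m M)) P = ev (row_form x) (P *m M^T).
Proof.
rewrite !ev_row_form; under eq_bigr do rewrite mxE mulr_suml.
rewrite exchange_big /=; apply: eq_bigr => k _; rewrite mxE mulr_sumr.
by apply: eq_bigr => h _; rewrite mxE; ring.
Qed.

Lemma no_triple_point_mul (a : 'I_5 -> 'rV[K]_3) (M : 'M[K]_3) : M \in unitmx ->
  no_triple_point (fun j => row_form (a j)) -> no_triple_point (fun j => row_form (a j *m M)).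
Proof.
move=> Mu gen i j k ij ik jk P; rewrite !ev_row_form_mul => zi zj zk.
have := gen i j k ij ik jk _ zi zj zk => /(congr1 (mulmx^~ (invmx M^T))).
by rewrite mulmxK ?unitmx_tr // mul0mx.
Qed.

Definition row3 (x y z : K) : 'rV[K]_3 := \row_k (nth 0 [:: x; y; z] k).

Lemma row3_eq0 x y z : row3 x y z = 0 -> [/\ x = 0, y = 0 & z = 0].
Proof.
by move=> /rowP h; have := h 0; have := h 1; have := h 2; rewrite !mxE /= => -> -> ->.
Qed.

Lemma ev_row_form3 x y z (q : 'rV[K]_3) :
  ev (row_form q) (row3 x y z) = q 0 0 * x + q 0 1 * y + q 0 2 * z.
Proof. by rewrite ev_lform !mxE. Qed.

(** The first three forms are the new coordinates. Each condition on the
    coefficients of the others is tested on an explicit point that would be a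
    common zero of three forms if it failed. *)
Lemma normal_coordinates (a : 'I_5 -> 'rV[K]_3) d :
  no_triple_point (fun j => row_form (a j)) ->
  exists (M : 'M[K]_3) (a1 b1 c1 a2 b2 c2 : K),
    [/\ M \in unitmx, general_coefficients a1 b1 c1 a2 b2 c2
      & lin_subst M (\sum_j row_form (a j) ^+ d) = five_powers_form d a1 b1 c1 a2 b2 c2].
Proof.
move=> gen.
(* The indices of the first three forms. *)
pose w : 'I_3 -> 'I_5 := widen_ord (isT : 3 <= 5)%N.
pose A := \matrix_(i, k) a (w i) 0 k.
have Au : A \in unitmx.
  rewrite -unitmx_tr unitmxE unitfE; apply/det0P => -[P P0 PA].
  have z i : ev (row_form (a (w i))) P = 0.
    transitivity ((P *m A^T) 0 i); last by rewrite PA mxE.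
    by rewrite ev_row_form mxE; apply: eq_bigr => k _; rewrite !mxE mulrC.
  by have /eqP [] := P0; apply: (gen _ _ _ _ _ _ _ (z 0) (z 1) (z 2)).
pose M := invmx A; have Mu : M \in unitmx by rewrite unitmx_inv.
pose b j := a j *m M.
have genb : no_triple_point (fun j => row_form (b j)) by exact: no_triple_point_mul.
have bw i : b (w i) = row i 1%:M.
  rewrite -(mulmxV Au) row_mul /b; congr (_ *m _); apply/rowP => k; rewrite !mxE.
  by [].
pose j0 : 'I_5 := @Ordinal 5 0 isT. pose j1 : 'I_5 := @Ordinal 5 1 isT.
pose j2 : 'I_5 := @Ordinal 5 2 isT. pose j3 : 'I_5 := @Ordinal 5 3 isT.
pose j4 : 'I_5 := @Ordinal 5 4 isT.
have e0 x y z : ev (row_form (b j0)) (row3 x y z) = x.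
  have -> : j0 = w 0 by exact: val_inj.
  by rewrite bw ev_row_form3 !mxE /= mul1r !mul0r !addr0.
have e1 x y z : ev (row_form (b j1)) (row3 x y z) = y.
  have -> : j1 = w 1 by exact: val_inj.
  by rewrite bw ev_row_form3 !mxE /= mul1r !mul0r add0r addr0.
have e2 x y z : ev (row_form (b j2)) (row3 x y z) = z.
  have -> : j2 = w 2 by exact: val_inj.
  by rewrite bw ev_row_form3 !mxE /= mul1r !mul0r !add0r.
have nz j : j \in [:: j3; j4] -> [/\ b j 0 0 != 0, b j 0 1 != 0 & b j 0 2 != 0].
  move=> jin; have [n0 n1 n2] : [/\ j0 != j, j1 != j & j2 != j].
    by move: jin; rewrite !inE => /orP[] /eqP ->.
  split; apply/eqP => z.
  - suff /row3_eq0[/eqP] : row3 1 0 0 = 0 by rewrite oner_eq0.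
    by apply: (genb j1 j2 j) => //; rewrite ?e1 ?e2 // ev_row_form3 z; ring.
  - suff /row3_eq0[_ /eqP] : row3 0 1 0 = 0 by rewrite oner_eq0.
    by apply: (genb j0 j2 j) => //; rewrite ?e0 ?e2 // ev_row_form3 z; ring.
  - suff /row3_eq0[_ _ /eqP] : row3 0 0 1 = 0 by rewrite oner_eq0.
    by apply: (genb j0 j1 j) => //; rewrite ?e0 ?e1 // ev_row_form3 z; ring.
have [a1N0 b1N0 c1N0] := nz j3 (mem_head _ _).
have [a2N0 b2N0 c2N0] := nz j4 isT.
exists M, (b j3 0 0), (b j3 0 1), (b j3 0 2), (b j4 0 0), (b j4 0 1), (b j4 0 2).
split=> //; first split.
- by apply/and5P; split=> //; apply/andP.
- split; apply/eqP => z.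
  + suff /row3_eq0[/eqP] : row3 (b j3 0 1) (- b j3 0 0) 0 = 0 by rewrite (negbTE b1N0).
    apply: (genb j2 j3 j4) => //; rewrite ?e2 // ev_row_form3; first by ring.
    by rewrite mulr0 addr0 -[RHS]oppr0 -z; ring.
  + suff /row3_eq0[/eqP] : row3 (b j3 0 2) 0 (- b j3 0 0) = 0 by rewrite (negbTE c1N0).
    apply: (genb j1 j3 j4) => //; rewrite ?e1 // ev_row_form3; first by ring.
    by rewrite mulr0 addr0 -[RHS]oppr0 -z; ring.
  + suff /row3_eq0[_ /eqP] : row3 0 (b j3 0 2) (- b j3 0 1) = 0 by rewrite (negbTE c1N0).
    apply: (genb j0 j3 j4) => //; rewrite ?e0 // ev_row_form3; first by ring.
    by rewrite mulr0 add0r -[RHS]oppr0 -z; ring.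
rewrite lin_subst_power_sum five_sum /five_powers_form.
have varE i : row_form (row i 1%:M) = var K i.
  rewrite row_formE (bigD1 i) //= !mxE eqxx scale1r big1 ?addr0 // => k ki.
  by rewrite !mxE eq_sym (negbTE ki) scale0r.
have h i j : j = w i -> row_form (b j) = var K i by move=> ->; rewrite bw varE.
have h0 : row_form (b j0) = var K 0 by apply: h; exact: val_inj.
have h1 : row_form (b j1) = var K 1 by apply: h; exact: val_inj.
have h2 : row_form (b j2) = var K 2 by apply: h; exact: val_inj.
by rewrite -h0 -h1 -h2.
Qed.
End NormalCoordinates.

(** * Singularities of a general sum of five powers *)

(** The normal form makes sense in every degree, so the degrees below 3 have to be
    excluded for the statement on singularities: 0 and 1 contradict the hypotheses
    on f, and a conic that essentially involves the three variables is smooth. *)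
Lemma five_double_lines (K : numClosedFieldType) (d : nat) (f : mpoly 3 K)
    (l : 'I_5 -> mpoly 3 K) :
  f \is ishomog1 d mdeg ->
  essentially_ternary f ->
  waring_rank d f 5 ->
  power_sum d f l ->
  only_double_points l ->
  [/\ (double_points l #= `I_10)%card,
      (exists (M : 'M[K]_3) (a1 b1 c1 a2 b2 c2 : K),
        [/\ M \in unitmx, general_coefficients a1 b1 c1 a2 b2 c2
          & lin_subst M f = five_powers_form d a1 b1 c1 a2 b2 c2])
    & forall (M : 'M[K]_3) (a1 b1 c1 a2 b2 c2 : K),
        M \in unitmx -> general_coefficients a1 b1 c1 a2 b2 c2 ->
        lin_subst M f = five_powers_form d a1 b1 c1 a2 b2 c2 ->
        forall p : 'rV[K]_3, singular_point (lin_subst M f) p ->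
          (exists2 m : nat, (1 <= m)%N & type_A m (lin_subst M f) p) /\
          (p 0 0 * p 0 1 * p 0 2 = 0 -> type_A 1 (lin_subst M f) p)].
Proof.
move=> hf ess rk [hl def_f] dbl.
have [a def_l] : exists a : 'I_5 -> 'rV[K]_3, l = (fun j => row_form (a j)).
  have /choice [a ha] : forall j, exists x, l j = row_form x by move=> j; exact: homog1_row_form.
  by exists a; apply/funext.
rewrite def_l in def_f dbl *.
have gen := only_double_no_triple dbl.
split.
- exact: card_double_points.
- by rewrite def_f; exact: normal_coordinates.
move=> M a1 b1 c1 a2 b2 c2 Mu gc fE p sing.
case: d => [|[|[|e]]] in hf rk def_f fE *.
- by case: (@degree0_not_essentially_ternary K 5 (fun j => row_form (a j))); rewrite -def_f.
- by have := degree1_waring_rank hf rk.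
- by have := quadric_nonsingular ess def_f Mu sing.
by rewrite fE in sing *; exact: five_powers_singularities.
Qed.

Theorem proposition5p4 (R : realType) (d : nat) (f : mpoly 3 R[i])
    (l : 'I_5 -> mpoly 3 R[i]) :
  f \is ishomog1 d mdeg ->
  reduced f ->
  essentially_ternary f ->
  waring_rank d f 5 ->
  waring_decomposition d f l ->
  only_double_points l ->
  [/\ (double_points l #= `I_10)%card,
      (exists (M : 'M[R[i]]_3) (a1 b1 c1 a2 b2 c2 : R[i]),
        [/\ M \in unitmx, general_coefficients a1 b1 c1 a2 b2 c2
          & lin_subst M f = five_powers_form d a1 b1 c1 a2 b2 c2])
    & forall (M : 'M[R[i]]_3) (a1 b1 c1 a2 b2 c2 : R[i]),
        M \in unitmx -> general_coefficients a1 b1 c1 a2 b2 c2 ->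
        lin_subst M f = five_powers_form d a1 b1 c1 a2 b2 c2 ->
        forall p : 'rV[R[i]]_3, singular_point (lin_subst M f) p ->
          (exists2 m : nat, (1 <= m)%N & type_A m (lin_subst M f) p) /\
          (p 0 0 * p 0 1 * p 0 2 = 0 -> type_A 1 (lin_subst M f) p)].
Proof. by move=> hf _ ess rk [_ ps] dbl; exact: five_double_lines. Qed.
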